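(* Let $1<\alpha\le 2$, $\theta\in\mathbb{R}$ with $|\theta|\le\min\{\alpha,2-\alpha\}$, $\nu\in\mathbb{R}$, $d>0$ and $T>0$ be constants, and let $g_0\in L^2(\mathbb{R})$ be real-valued. Consider the inverse source problem of determining the source $f\in L^2(\mathbb{R})$ from the final observation $u(\cdot,T)$, where $u$ is the solution of $$\frac{\partial u(x,t)}{\partial t}=-\nu\frac{\partial u(x,t)}{\partial x}+d\,D^\alpha_\theta u(x,t)+f(x),\quad x\in\mathbb{R},\ t>0,\qquad u(x,0)=g_0(x).$$ This inverse problem is not stable in the sense of Hadamard: there exist real-valued $f\in L^2(\mathbb{R})$ and $f_n\in L^2(\mathbb{R})$, $n\ge1$, with corresponding solutions $u$ and $u_n$ (for the same initial datum $g_0$), such that $\|u_n(\cdot,T)-u(\cdot,T)\|_{L^2(\mathbb{R})}\to0$ as $n\to\infty$ while $\|f_n-f\|_{L^2(\mathbb{R})}$ does not tend to $0$.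
   Context: The Fourier transform in $x$ is $\hat h(k)=\int_{-\infty}^{+\infty}h(y)e^{iky}\,dy$ (extended to $L^2(\mathbb{R})$ as usual), with inverse $h(x)=\frac1{2\pi}\int_{-\infty}^{+\infty}\hat h(k)e^{-ikx}\,dk$. The symbol $\psi^\alpha_\theta(k)=|k|^\alpha e^{i\,\mathrm{sign}(k)\,\theta\pi/2}$ is used, with $\psi^\alpha_\theta(0)=0$. The Riesz-Feller fractional derivative $D^\alpha_\theta$ of order $\alpha$ and skewness $\theta$ in the variable $x$ is the operator with Fourier symbol $-\psi^\alpha_\theta$: the Fourier transform of $D^\alpha_\theta c(\cdot,t)$ is $-\psi^\alpha_\theta(k)\hat c(k,t)$. With this convention the Fourier transform of $\partial_x c$ is $-ik\,\hat c$. Solutions of the problem with source $f$ are understood in the Fourier sense: $u(\cdot,t)\in L^2(\mathbb{R})$ for every $t\ge 0$ with $u(\cdot,0)=g_0$, and there is a measurable function $\hat u(k,t)$ on $\mathbb{R}\times[0,\infty)$ which for every $t\ge0$ coincides for almost every $k$ with the Fourier transform of $u(\cdot,t)$, and such that for almost every $k$ the map $t\mapsto\hat u(k,t)$ is continuous on $[0,\infty)$, differentiable on $(0,\infty)$, and satisfies $\partial_t\hat u(k,t)=(i\nu k-d\,\psi^\alpha_\theta(k))\hat u(k,t)+\hat f(k)$ for $t>0$, with $\hat u(k,0)=\hat g_0(k)$. Stability in the sense of Hadamard means that the source depends continuously on the final observation: convergence of the final observations in $L^2(\mathbb{R})$ implies convergence of the corresponding sources in $L^2(\mathbb{R})$.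 *)

(* Defs.v *)
From mathcomp Require Import all_boot all_order all_algebra.
From mathcomp Require Import complex.
From mathcomp Require Import all_classical all_reals all_analysis.

Set Implicit Arguments.
Unset Strict Implicit.
Unset Printing Implicit Defensive.

Import Order.TTheory GRing.Theory Num.Theory.
Import numFieldNormedType.Exports.

Local Open Scope classical_set_scope.
Local Open Scope ring_scope.
Local Open Scope complex_scope.

Section Defs.
Context {R : realType}.
Local Notation mu := (@lebesgue_measure R).
Local Notation Re := (@complex.Re R).
Local Notation Im := (@complex.Im R).

Implicit Types (h H g f : R -> R[i]) (u : R -> R -> R[i]).

(* R[i] carries no measurable structure in the library: measurability,
   integrability, integrals and derivatives with respect to a real variable
   are taken on real and imaginary parts. *)

Definition cfun (f : R -> R) : R -> R[i] := fun x => (f x)%:C.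

Definition L1 h :=
  (Re \o h) \in Lfun mu 1%:E /\ (Im \o h) \in Lfun mu 1%:E.

Definition L2 h :=
  (Re \o h) \in Lfun mu 2%:E /\ (Im \o h) \in Lfun mu 2%:E.

Definition normL2 h : \bar R :=
  Lnorm mu 2%:E (fun x => (ComplexField.Normc.normc (h x))%:E).

Definition cvgL2 (h_ : nat -> R -> R[i]) h :=
  (fun n => normL2 (h_ n \- h)) @ \oo --> 0%E.

(* e^{i a} *)
Definition cis (a : R) : R[i] := cos a +i* sin a.

Definition fourierL1 h (k : R) : R[i] :=
  (\int[mu]_y Re (h y * cis (k * y)))%R
  +i* (\int[mu]_y Im (h y * cis (k * y)))%R.

(* [H] is (a representative of) the Fourier transform of [h] in L^2, i.e. the
   value at [h] of the continuous extension to L^2 of [fourierL1] restricted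
   to the dense subspace of functions both in L^1 and in L^2. *)
Definition is_fourierL2 h H :=
  [/\ L2 h, L2 H &
      exists h_ : nat -> R -> R[i],
        [/\ forall n, L1 (h_ n) /\ L2 (h_ n),
            cvgL2 h_ h &
            cvgL2 (fun n => fourierL1 (h_ n)) H]].

(* As 0 `^ alpha = 0 for alpha != 0, this symbol vanishes at k = 0. *)
Definition psi (alpha theta k : R) : R[i] :=
  (`|k| `^ alpha)%:C * cis (Num.sg k * (theta * pi / 2)).

(* [u x t] solves, in the Fourier sense,
     du/dt = - nu du/dx + d D^alpha_theta u + f(x),  u(x, 0) = g0(x);
   [uhat k t] is the representative of the Fourier transform of u(., t).
   Only the values at t >= 0 matter. *)
Definition is_solution (alpha theta nu d : R) (g0 f : R -> R[i]) u :=
  [/\ forall t, 0 <= t -> L2 (u ^~ t),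
      {ae mu, forall x, u x 0 = g0 x} &
      exists (uhat : R -> R -> R[i]) (g0hat fhat : R -> R[i]),
      [/\ is_fourierL2 g0 g0hat, is_fourierL2 f fhat,
          measurable_fun ([set: R] `*` `[0, +oo[ : set (R * R))
            (fun kt : R * R => Re (uhat kt.1 kt.2)) /\
          measurable_fun ([set: R] `*` `[0, +oo[ : set (R * R))
            (fun kt : R * R => Im (uhat kt.1 kt.2)),
          forall t, 0 <= t -> exists v : R -> R[i],
            is_fourierL2 (u ^~ t) v /\ {ae mu, forall k, uhat k t = v k} &
          {ae mu, forall k,
            [/\ {within `[0, +oo[, continuous (Re \o uhat k)},
                {within `[0, +oo[, continuous (Im \o uhat k)},
                forall t, 0 < t ->
                  let rhs := ('i * (nu * k)%:C - d%:C * psi alpha theta k)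
                             * uhat k t + fhat k in
                  is_derive t (1 : R) (Re \o uhat k) (Re rhs) /\
                  is_derive t (1 : R) (Im \o uhat k) (Im rhs) &
                uhat k 0 = g0hat k]}]].

End Defs.

(* Main.v *)
Require Import Defs.
From mathcomp Require Import all_boot all_order all_algebra.
From mathcomp Require Import complex.
From mathcomp Require Import all_classical all_reals all_analysis.
From mathcomp Require Import measurable_realfun.
From mathcomp Require Import ring lra.

(* Writing the problem on the Fourier side, the final state depends on the
   source through multiplication by (e^{T phi} - 1) / phi, where
   phi(k) = i nu k - d psi(k) has real part - d cos(theta pi / 2) |k|^alpha;
   this multiplier is in L^2. Hence the L^2-normalized
   spikes sqrt(n+1) 1_[0,1/(n+1)], whose transforms are O(1 / sqrt(n+1))
   uniformly in k, produce final states tending to 0.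

   Fourier transforms of arbitrary L^2 functions, and functions with a given L^2
   transform, are obtained as limits of step functions. For real functions it
   is enough to treat the Hartley transform, with kernel cos(kx) + sin(kx):
   its even and odd parts are the cosine and sine transforms. With e_a the
   signed indicator of the interval between 0 and a, a scaling argument shows
   that |e_a - e_b|^2 = |a - b| becomes C |a - b| after transformation, for a
   constant C whose value is irrelevant; so the transform is an isometry up to
   scaling, and, being symmetric, it has dense range. *)

Import Order.TTheory GRing.Theory Num.Theory.
Import numFieldNormedType.Exports.

Set Implicit Arguments.
Unset Strict Implicit.
Unset Printing Implicit Defensive.

Local Open Scope classical_set_scope.
Local Open Scope ring_scope.
Local Open Scope complex_scope.

(** * The space L^2 of the line *)

(** The difficulty lies in exhibiting solutions rather than in estimating them. At each frequency
    the equation is solved in closed form, but every u(., t) then has to be recovered from its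
    transform, so the L^2 transform must be onto; the dense range serves this purpose. The
    multiplier is square integrable for two reasons. Near k = 0, where phi vanishes, |e^{T phi} - 1|
    is at most a constant times T |phi|. Elsewhere |theta| <= 2 - alpha < 1 makes cos(theta pi / 2)
    positive, so that |e^{T phi}| <= 1 and |phi| grows at least like |k|. The reference source is 0
    and all solutions share one homogeneous part, so only the evolution of the spikes has to be
    small. Estimates are made on squared norms, with |f + g|^2 <= 2 |f|^2 + 2 |g|^2; the numerical
    constants that this produces are not sharp. *)

Section square_integrable.
Context {R : realType}.
Local Notation mu := (@lebesgue_measure R).
Local Notation L2r := (Lfun mu 2%:E).
Implicit Types (f g h : R -> R).

(** The real-valued integral applies [fine], so a divergent integral silently reads as 0. This is
    why most facts about [dot] ask for membership in L^2, and why [sqn_EFin] is there to return to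
    extended reals. *)
Definition dot f g : R := \int[mu]_x (f x * g x).
Definition sqn f : R := dot f f.

Lemma Lfun2P f : f \in L2r <->
  measurable_fun setT f /\ mu.-integrable setT (EFin \o (fun x => f x * f x)).
Proof.
split=> [f2|[mf intf]].
  split; first by move: f2 => /andP[+ _]; rewrite inE.
  by have := Lfun2_integrable_sqr f2; apply: eq_integrable => // x _; rewrite /= expr2.
apply/andP; split; first by rewrite inE.
rewrite inE /= /finite_norm unlock /Lnorm poweR_lty//.
case/integrableP: intf => _; apply: le_lt_trans.
rewrite le_eqVlt; apply/orP; left; apply/eqP.
apply: eq_integral => x _ /=.
by rewrite powR_mulrn// -expr2 normrX.
Qed.

Lemma measurable_Lfun2 f : f \in L2r -> measurable_fun setT f.
Proof. by case/Lfun2P. Qed.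

Lemma integrable_dot f g : f \in L2r -> g \in L2r ->
  mu.-integrable setT (EFin \o (fun x => f x * g x)).
Proof. by move=> f2 g2; apply/Lfun1_integrable; exact: Lfun2_mul_Lfun1. Qed.

Lemma Lfun2_le f g : measurable_fun setT g -> f \in L2r ->
  (forall x, `|g x| <= `|f x|) -> g \in L2r.
Proof.
move=> mg /Lfun2P[mf intf] gf; apply/Lfun2P; split=> //.
apply: le_integrable intf => //.
  by apply/measurable_EFinP; exact: measurable_funM.
by move=> x _ /=; rewrite lee_fin !normrM ler_pM.
Qed.

Lemma Lfun2_0 : (fun=> 0) \in L2r.
Proof.
apply/Lfun2P; split=> //.
rewrite [X in _.-integrable _ X](_ : _ = cst 0%E); first exact: (integrable0 mu setT).
by apply/funext => x /=; rewrite mul0r.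
Qed.

Lemma Lfun2Z a f : f \in L2r -> (fun x => a * f x) \in L2r.
Proof.
move=> f2; rewrite (_ : (fun x => _) = a \o* f); first exact: Lfun_scale (ler1n R 2) f2.
by apply/funext => x /=; rewrite mulrC.
Qed.

Lemma Lfun2D f g : f \in L2r -> g \in L2r -> (fun x => f x + g x) \in L2r.
Proof.
have p1 : (1 <= 2%:E :> \bar R)%E by rewrite lee_fin ler1n.
exact: (Lfun_addr_closed mu p1).2.
Qed.

Lemma Lfun2B f g : f \in L2r -> g \in L2r -> (fun x => f x - g x) \in L2r.
Proof.
move=> f2 /(Lfun2Z (-1)) g2; rewrite (_ : (fun x => _) = (fun x => f x + -1 * g x)).
  exact: Lfun2D.
by apply/funext => x; rewrite mulN1r.
Qed.

Lemma dotC f g : dot f g = dot g f.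
Proof. by apply: eq_Rintegral => x _; rewrite mulrC. Qed.

Lemma dotDl f g h : f \in L2r -> g \in L2r -> h \in L2r ->
  dot (fun x => f x + g x) h = dot f h + dot g h.
Proof.
move=> f2 g2 h2; rewrite /dot -RintegralD//; [|exact: integrable_dot..].
by apply: eq_Rintegral => x _; rewrite mulrDl.
Qed.

Lemma dotZl a f h : f \in L2r -> h \in L2r ->
  dot (fun x => a * f x) h = a * dot f h.
Proof.
move=> f2 h2; rewrite /dot -RintegralZl//; last exact: integrable_dot.
by apply: eq_Rintegral => x _; rewrite mulrA.
Qed.

Lemma dot0l h : dot (fun=> 0) h = 0.
Proof.
rewrite /dot; under eq_Rintegral do rewrite mul0r.
by rewrite Rintegral_cst// mul0r.
Qed.

Lemma dotBl f g h : f \in L2r -> g \in L2r -> h \in L2r ->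
  dot (fun x => f x - g x) h = dot f h - dot g h.
Proof.
move=> f2 g2 h2; rewrite /dot -RintegralB//; [|exact: integrable_dot..].
by apply: eq_Rintegral => x _; rewrite mulrBl.
Qed.

Lemma dotBr f g h : f \in L2r -> g \in L2r -> h \in L2r ->
  dot h (fun x => f x - g x) = dot h f - dot h g.
Proof. by move=> *; rewrite dotC dotBl// !(dotC h). Qed.

Lemma dotZr a f h : f \in L2r -> h \in L2r ->
  dot h (fun x => a * f x) = a * dot h f.
Proof. by move=> *; rewrite dotC dotZl// (dotC h). Qed.

Lemma sqn_ge0 f : 0 <= sqn f.
Proof. by apply: Rintegral_ge0 => x _; rewrite -expr2 sqr_ge0. Qed.

Lemma sqnB f g : f \in L2r -> g \in L2r ->
  sqn (fun x => f x - g x) = sqn f - 2 * dot f g + sqn g.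
Proof.
move=> f2 g2; have fg2 := Lfun2B f2 g2.
by rewrite /sqn dotBl// dotBr// dotBr// (dotC g f); ring.
Qed.

Lemma sqnBC f g : sqn (fun x => f x - g x) = sqn (fun x => g x - f x).
Proof. by apply: eq_Rintegral => x _; ring. Qed.

Lemma sqnZ a f : f \in L2r -> sqn (fun x => a * f x) = a ^+ 2 * sqn f.
Proof.
by move=> f2; rewrite /sqn dotZl ?Lfun2Z// dotZr// mulrA -expr2.
Qed.

(** Parallelogram law with the nonnegative term |f - g|^2 dropped. It replaces Minkowski's
    inequality and avoids square roots. *)
Lemma sqnD_le f g : f \in L2r -> g \in L2r ->
  sqn (fun x => f x + g x) <= 2 * sqn f + 2 * sqn g.
Proof.
move=> f2 g2; have gN2 := Lfun2Z (-1) g2.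
have := sqn_ge0 (fun x => f x - g x); rewrite sqnB//.
have -> : (fun x => f x + g x) = (fun x => f x - -1 * g x).
  by apply/funext => x; ring.
rewrite sqnB// sqnZ// dotZr//; lra.
Qed.

Lemma sqn_tri h f g : f \in L2r -> g \in L2r -> h \in L2r ->
  sqn (fun x => f x - g x) <=
  2 * sqn (fun x => f x - h x) + 2 * sqn (fun x => h x - g x).
Proof.
move=> f2 g2 h2; apply: le_trans (sqnD_le (Lfun2B f2 h2) (Lfun2B h2 g2)).
by rewrite le_eqVlt; apply/orP; left; apply/eqP; apply: eq_Rintegral => x _; ring.
Qed.

Lemma sqn_EFin f : f \in L2r -> (\int[mu]_x ((f x) ^+ 2)%:E = (sqn f)%:E)%E.
Proof.
move=> f2; rewrite /sqn /dot /Rintegral fineK; last first.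
  by apply: integrable_fin_num => //; exact: integrable_dot.
by apply: eq_integral => x _; rewrite expr2.
Qed.

End square_integrable.

(** * Completeness of L^2 *)

Lemma geometric_cauchy_cvg (R : realType) (a : nat -> R) (c : R) : 0 <= c ->
  (forall n, `|a n.+1 - a n| <= c / 2 ^+ n) ->
  exists2 l, a @ \oo --> l & forall n, `|a n - l| <= 2 * c / 2 ^+ n.
Proof.
move=> c0 ac.
have p2 n : 0 < 2 ^+ n :> R by rewrite exprn_gt0.
(* The difference on the right is the exact partial sum of the geometric series, since c / 2^m = 2c
   / 2^m - 2c / 2^(m+1); in this form the induction closes. *)
have key n k : `|a (n + k)%N - a n| <= 2 * c / 2 ^+ n - 2 * c / 2 ^+ (n + k).
  elim: k => [|k IH]; first by rewrite addn0 !subrr normr0.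
  rewrite addnS -[a _.+1](subrK (a (n + k)%N)) -addrA.
  apply: le_trans (ler_normD _ _) _; apply: le_trans (lerD (ac _) IH) _.
  rewrite exprS invfM; set y := (2 ^+ (n + k))^-1; lra.
have key' n k : `|a (n + k)%N - a n| <= 2 * c / 2 ^+ n.
  apply: le_trans (key n k) _; rewrite gerBl.
  by rewrite divr_ge0 ?mulr_ge0// ltW.
have c2 : (fun n => 2 * c / 2 ^+ n) @ \oo --> 0.
  rewrite -[X in _ --> X](mulr0 (2 * c)); apply: cvgMr.
  have : (fun n => (2^-1 : R) ^+ n) @ \oo --> 0.
    by apply: cvg_expr; rewrite ger0_norm ?invr_ge0// invf_lt1// ltr1n.
  by apply: cvg_trans; apply: near_eq_cvg; apply: nearW => n; rewrite exprVn.
have acvg : cvg (a @ \oo).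
  apply/cauchy_cvgP; apply: cauchy_exP => e e0.
  have /cvgrPdist_lt/(_ e e0)[N _ /(_ N (leqnn N))] := c2.
  rewrite /= sub0r normrN => /(le_lt_trans (ler_norm _)) Ne.
  exists (a N); exists N => // k /= Nk.
  rewrite /ball /= distrC -(subnKC Nk); exact: le_lt_trans (key' _ _) Ne.
exists (lim (a @ \oo)) => // n.
rewrite distrC.
have : (fun k => `|a k - a n|) @ \oo --> `|lim (a @ \oo) - a n|.
  by apply: cvg_norm; apply: cvgB => //; exact: cvg_cst.
move=> /cvg_lim <- //; apply: limr_le.
  by apply/cvg_ex; eexists; apply: cvg_norm; apply: cvgB; [exact: acvg|exact: cvg_cst].
by exists n => // k /= nk; rewrite -(subnKC nk); exact: key'.
Qed.

Section L2_complete.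
Context {R : realType}.
Local Notation mu := (@lebesgue_measure R).
Local Notation L2r := (Lfun mu 2%:E).

(** Riesz-Fischer for a fast Cauchy sequence. The weighted sum S of the 4^n d_n^2 has integral at
    most the sum of 4^n / 8^n, which is 2, so S is finite almost everywhere. There |d_n| <= sqrt S /
    2^n, which gives pointwise convergence, and the same S dominates the error: |h_n - H|^2 <= 4 S /
    4^n. *)
Lemma Lfun2_complete_fast (h : nat -> R -> R) : (forall n, h n \in L2r) ->
  (forall n, sqn (fun x => h n.+1 x - h n x) <= 1 / 8 ^+ n) ->
  exists2 H, H \in L2r & (fun n => sqn (fun x => h n x - H x)) @ \oo --> 0.
Proof.
move=> h2 hd.
pose d n x := h n.+1 x - h n x.
have d2 n : d n \in L2r by exact: Lfun2B.
pose v n x := (4 ^+ n * (d n x) ^+ 2)%:E.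
have v0 n x : (0 <= v n x)%E by rewrite lee_fin mulr_ge0 ?sqr_ge0 ?exprn_ge0.
have mv n : measurable_fun setT (v n).
  apply/measurable_EFinP; apply: measurable_funM => //.
  by apply: measurable_funX; exact: measurable_Lfun2.
pose S x := (\sum_(0 <= n <oo) v n x)%E.
have S0 x : (0 <= S x)%E by apply: nneseries_ge0 => n _ _; exact: v0.
have mS : measurable_fun setT S.
  by apply: ge0_emeasurable_sum => // n x _ _; exact: v0.
have intS : (\int[mu]_x S x <= 2%:E)%E.
  rewrite integral_nneseries//.
  (* The terms 1 / 2^n are written 2 / 2^(n+1) to fit [epsilon_trick], which sums them to 2. *)
  apply: (@le_trans _ _ (\sum_(0 <= i <oo) (0 + (2 / (2 ^ i.+1)%:R)%:E))%E); last first.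
    have := @epsilon_trick R (fun=> 0%E) 2 xpredT (fun=> lexx _) (ler0n _ 2).
    by rewrite [X in (_ <= X + _)%E]eseries0// [leRHS]add0e.
  apply: lee_nneseries => n _.
    by rewrite integral_ge0.
  rewrite /v; under eq_integral do rewrite EFinM.
  rewrite ge0_integralZl//=; last 2 first.
  - apply/measurable_EFinP; apply: measurable_funX; exact: measurable_Lfun2.
  - by move=> x _; rewrite lee_fin sqr_ge0.
  rewrite sqn_EFin// add0e -EFinM lee_fin.
  apply: le_trans (ler_wpM2l _ (hd n)) _; first by rewrite exprn_ge0.
  rewrite (_ : 8 = 4 * 2); last by ring.
  rewrite exprMn natrX exprS.
  have a0 : (4 ^+ n : R) != 0 by rewrite expf_neq0.
  have b0 : (2 ^+ n : R) != 0 by rewrite expf_neq0.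
  by rewrite le_eqVlt; apply/orP; left; apply/eqP; field; rewrite a0 b0.
have Sint : mu.-integrable setT S.
  apply/integrableP; split=> //.
  under eq_integral do rewrite gee0_abs//.
  by rewrite (le_lt_trans intS)// ltry.
pose E := [set x | S x < +oo]%E.
have mE : measurable E.
  by rewrite -[E]setTI; exact: emeasurable_fun_infty_o.
have dS n x : E x -> `|d n x| <= Num.sqrt (fine (S x)) / 2 ^+ n.
  move=> Ex; have fS : S x \is a fin_num by rewrite ge0_fin_numE.
  have : (v n x <= S x)%E.
    have := @nneseries_lim_ge R (v ^~ x) xpredT 0 n.+1 (fun k _ _ => v0 k x).
    apply: le_trans; rewrite big_mkord big_ord_recr/= leeDr//.
    by rewrite sume_ge0.
  rewrite -(fineK fS) lee_fin => vS.
  rewrite ler_pdivlMr ?exprn_gt0//.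
  rewrite -(ger0_norm (exprn_ge0 n (ler0n R 2))) -normrM -sqrtr_sqr ler_wsqrtr//.
  by apply: le_trans vS; rewrite exprMn exprAC (_ : 2 ^+ 2 = 4) 1?mulrC//; ring.
have hE x : E x -> exists2 l, h ^~ x @ \oo --> l &
    forall n, `|h n x - l| <= 2 * Num.sqrt (fine (S x)) / 2 ^+ n.
  by move=> Ex; apply: geometric_cauchy_cvg => // n; exact: dS.
(* With the value 0 off [E], [H] is the limit at every point of [h n * \1_E], hence measurable. *)
pose H x := if pselect (E x) is left Ex then sval (cid2 (hE x Ex)) else 0.
have mH : measurable_fun setT H.
  apply: (@measurable_fun_cvg _ _ _ _ (fun n x => h n x * \1_E x)).
    move=> n; apply: measurable_funM; first exact: measurable_Lfun2.
    exact: measurable_indic.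
  move=> x _; rewrite /H; case: pselect => [Ex|nEx].
    case: (cid2 _) => l /= hl _; rewrite indicE mem_set//.
    by under eq_fun do rewrite mulr1.
  rewrite indicE memNset//; under eq_fun do rewrite mulr0; exact: cvg_cst.
have aeE : {ae mu, forall x, E x}.
  have := integrable_ae measurableT Sint; apply: filterS => x /(_ I).
  by rewrite ge0_fin_numE.
have le_int n : (\int[mu]_x ((h n x - H x) ^+ 2)%:E <= (8 / 4 ^+ n)%:E)%E.
  apply: (@le_trans _ _ (\int[mu]_x ((4 / 4 ^+ n)%:E * S x)))%E; last first.
    rewrite ge0_integralZl//; do ?[by move=> x _; exact: S0|by rewrite lee_fin divr_ge0 ?exprn_ge0].
    rewrite (_ : 8 / 4 ^+ n = 4 / 4 ^+ n * 2); last by ring.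
    by rewrite [leRHS]EFinM lee_pmul ?integral_ge0// lee_fin divr_ge0 ?exprn_ge0.
  apply: ae_ge0_le_integral => //.
  - by move=> x _; rewrite lee_fin sqr_ge0.
  - apply/measurable_EFinP; apply: measurable_funX; apply: measurable_funB => //.
    exact: measurable_Lfun2.
  - by move=> x _; rewrite mule_ge0// lee_fin divr_ge0 ?exprn_ge0.
  - exact: measurable_funeM.
  move: aeE; apply: (@filterS _ _ (ae_filter_ringOfSetsType mu)) => x Ex _.
  have fS : S x \is a fin_num by rewrite ge0_fin_numE.
  have SS : 0 <= fine (S x) by exact: fine_ge0.
  rewrite -(fineK fS) -EFinM lee_fin /H; case: pselect => // Ex'.
  case: (cid2 _) => l /= _ /(_ n) hl.
  rewrite -real_normK ?num_real//.
  apply: le_trans (_ : (2 * Num.sqrt (fine (S x)) / 2 ^+ n) ^+ 2 <= _).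
    by rewrite ler_pXn2r// nnegrE// !(mulr_ge0, invr_ge0, exprn_ge0, sqrtr_ge0).
  rewrite !exprMn sqr_sqrtr// exprVn exprAC (_ : 2 ^+ 2 = 4); last by ring.
  by rewrite -!mulrA [_ * (_^-1)]mulrC.
have B2 n : (fun x => h n x - H x) \in L2r.
  apply/Lfun2P; split.
    by apply: measurable_funB => //; exact: measurable_Lfun2.
  apply/integrableP; split.
    by apply/measurable_EFinP; apply: measurable_funM;
      (apply: measurable_funB => //; exact: measurable_Lfun2).
  apply: le_lt_trans (ltry (8 / 4 ^+ n)); apply: le_trans (le_int n).
  rewrite le_eqVlt; apply/orP; left; apply/eqP; apply: eq_integral => x _.
  by rewrite /= -expr2 ger0_norm// sqr_ge0.
exists H.
  rewrite (_ : H = fun x => h 0 x - (h 0 x - H x)); first exact: Lfun2B.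
  by apply/funext => x; ring.
apply: (@squeeze_cvgr _ _ _ _ (fun=> 0) (fun n => 8 / 4 ^+ n)).
- by apply: nearW => n; rewrite sqn_ge0 -lee_fin -sqn_EFin//=.
- exact: cvg_cst.
rewrite -[X in _ --> X](mulr0 8); apply: cvgMr.
have : (fun n => (4^-1 : R) ^+ n) @ \oo --> 0.
  by apply: cvg_expr; rewrite ger0_norm ?invr_ge0// invf_lt1// ltr1n.
by apply: cvg_trans; apply: near_eq_cvg; apply: nearW => n; rewrite exprVn.
Qed.

End L2_complete.

(** * Step functions *)

Section combinations.
Context {R : realType}.
Local Notation mu := (@lebesgue_measure R).
Local Notation L2r := (Lfun mu 2%:E).
Implicit Types (E F : R -> R -> R) (s t : seq (R * R)).

(** The list of coefficients and indices is kept apart from the family [E]. A linear map on the span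
    is then a mere change of family, from [combo estep s] to [combo hstep s], and no independence of
    the representation has to be checked. *)
Definition combo E s (x : R) : R := \sum_(p <- s) p.1 * E p.2 x.

Lemma combo_cons E p s :
  combo E (p :: s) = (fun x => p.1 * E p.2 x + combo E s x).
Proof. by apply/funext => x; rewrite /combo big_cons. Qed.

Lemma combo_nil E : combo E [::] = (fun=> 0).
Proof. by apply/funext => x; rewrite /combo big_nil. Qed.

Lemma combo_cat E s t x : combo E (s ++ t) x = combo E s x + combo E t x.
Proof. by rewrite /combo big_cat. Qed.

Definition scale_combo (a : R) s := [seq (a * p.1, p.2) | p <- s].

Lemma combo_scale E a s x : combo E (scale_combo a s) x = a * combo E s x.
Proof.
rewrite /combo big_map mulr_sumr; apply: eq_bigr => p _; rewrite mulrA//.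
Qed.

Lemma combo_sub E s t :
  combo E (s ++ scale_combo (-1) t) = (fun x => combo E s x - combo E t x).
Proof. by apply/funext => x; rewrite combo_cat combo_scale mulN1r. Qed.

Lemma Lfun2_combo E s : (forall a, E a \in L2r) -> combo E s \in L2r.
Proof.
move=> E2; elim: s => [|p s IH]; first by rewrite combo_nil Lfun2_0.
by rewrite combo_cons; apply: Lfun2D IH; exact: Lfun2Z.
Qed.

Lemma dot_combo E F s t : (forall a, E a \in L2r) -> (forall a, F a \in L2r) ->
  dot (combo E s) (combo F t) =
  \sum_(p <- s) \sum_(q <- t) p.1 * q.1 * dot (E p.2) (F q.2).
Proof.
move=> E2 F2; have Et g : g \in L2r ->
    dot g (combo F t) = \sum_(q <- t) q.1 * dot g (F q.2).
  move=> g2; elim: t => [|q t IH]; first by rewrite combo_nil dotC dot0l big_nil.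
  rewrite combo_cons big_cons dotC dotDl// ?Lfun2_combo//; last exact: Lfun2Z.
  by rewrite dotZl// !(dotC _ g) IH.
elim: s => [|p s IH]; first by rewrite combo_nil dot0l big_nil.
rewrite combo_cons big_cons dotDl// ?Lfun2_combo//; last exact: Lfun2Z.
rewrite dotZl// ?Lfun2_combo// IH Et//; congr (_ + _).
by rewrite mulr_sumr; apply: eq_bigr => q _; rewrite mulrA.
Qed.

(** The squared norm of a combination depends only on the Gram matrix of the family, so proportional
    Gram matrices give proportional norms. *)
Lemma sqn_combo E F (C : R) s : (forall a, E a \in L2r) -> (forall a, F a \in L2r) ->
  (forall a b, dot (F a) (F b) = C * dot (E a) (E b)) ->
  sqn (combo F s) = C * sqn (combo E s).
Proof.
move=> E2 F2 EF; rewrite /sqn !dot_combo// mulr_sumr; apply: eq_bigr => p _.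
by rewrite mulr_sumr; apply: eq_bigr => q _; rewrite EF; ring.
Qed.

End combinations.

(** * Interval indicators and their density in L^2 *)

Section steps.
Context {R : realType}.
Local Notation mu := (@lebesgue_measure R).
Local Notation L2r := (Lfun mu 2%:E).

Definition ivl (a b x : R) : R := (a <= x < b)%R%:R.

(* The signed indicator of the interval between 0 and [a]. *)
Definition estep (a x : R) : R := ivl 0 a x - ivl a 0 x.

Lemma ivlE a b : ivl a b = \1_`[a, b[%classic.
Proof.
apply/funext => x; rewrite indicE /ivl; congr (nat_of_bool _)%:R.
by apply/idP/idP; rewrite inE /= in_itv.
Qed.

Lemma measurable_ivl a b : measurable_fun setT (ivl a b).
Proof. by rewrite ivlE; exact: measurable_indic. Qed.

Lemma ivl_sqr a b x : ivl a b x * ivl a b x = ivl a b x.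
Proof. by rewrite /ivl; case: (_ <= _ < _); rewrite ?mul0r ?mulr1. Qed.

Lemma integrable_ivl a b : mu.-integrable setT (EFin \o ivl a b).
Proof. by rewrite ivlE; exact: integrable_indic_itv. Qed.

Lemma Lfun2_ivl a b : ivl a b \in L2r.
Proof.
apply/Lfun2P; split; first exact: measurable_ivl.
by under eq_fun do rewrite ivl_sqr; exact: integrable_ivl.
Qed.

Lemma Lfun2_estep a : estep a \in L2r.
Proof. by apply: Lfun2B; exact: Lfun2_ivl. Qed.

Lemma integrable_estep a : mu.-integrable setT (EFin \o estep a).
Proof.
rewrite (_ : _ \o _ = (fun x => (ivl 0 a x)%:E - (ivl a 0 x)%:E)%E)//.
by apply: integrableB => //; exact: integrable_ivl.
Qed.

Lemma integral_ivl a b : a <= b -> \int[mu]_x ivl a b x = b - a.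
Proof.
move=> ab; rewrite ivlE /Rintegral integral_indic//= setIT lebesgue_measure_itv/=.
rewrite lte_fin; case: ltgtP ab => // -> _.
by rewrite subrr.
Qed.

Lemma sqn_ivl a b : a <= b -> sqn (ivl a b) = b - a.
Proof.
move=> ab; rewrite -(integral_ivl ab); apply: eq_Rintegral => x _.
exact: ivl_sqr.
Qed.

(** Every interval indicator is a difference of two members of the one-parameter family [estep], so
    this family spans the step functions while its geometry is given by the distances |a - b|
    alone. *)
Lemma estepB a b x : a <= b -> estep b x - estep a x = ivl a b x.
Proof.
by rewrite /estep /ivl => ab; case: (lerP a x); case: (lerP 0 x); case: (lerP b x);
  rewrite ?ltNge /=; case: (lerP a x); case: (lerP 0 x) => //=; case: (lerP b x) => //= *; lra.
Qed.

Lemma sqn_estepB a b : sqn (fun x => estep a x - estep b x) = `|a - b|.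
Proof.
wlog ab : a b / a <= b => [H|].
  by case: (leP a b) => [/H//|/ltW/H]; rewrite sqnBC distrC.
rewrite sqnBC distrC ger0_norm ?subr_ge0// -(sqn_ivl ab).
by congr sqn; apply/funext => x; exact: estepB.
Qed.

(** Continuous induction along [a, b]. Approximable intervals can be concatenated ([Qadd]), short
    ones near any point are approximable by a constant ([Qloc]), and the supremum of the endpoints
    reached from a has to be b. *)
Lemma step_approximation (h : R -> R) (a b e : R) : continuous h -> a <= b ->
  0 < e -> exists s, forall x, (a <= x < b -> `|combo estep s x - h x| <= e) /\
                               (~~ (a <= x < b) -> combo estep s x = 0).
Proof.
move=> ch ab e0.
pose Q c c' := exists s, forall x,
  (c <= x < c' -> `|combo estep s x - h x| <= e) /\
  (~~ (c <= x < c') -> combo estep s x = 0).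
have Qadd c m c' : c <= m <= c' -> Q c m -> Q m c' -> Q c c'.
  move=> /andP[cm mc'] [s hs] [t ht]; exists (s ++ t) => x; rewrite combo_cat.
  have [s1 s2] := hs x; have [t1 t2] := ht x; split=> [/andP[cx xc']|].
    have [mx|xm] := leP m x.
      by rewrite s2 ?add0r ?t1 ?mx//; apply/negP; lra.
    by rewrite t2 ?addr0 ?s1 ?cx//; apply/negP; lra.
  move=> /negP nx; rewrite s2 ?t2 ?addr0//; apply/negP => /andP[? ?]; apply: nx; lra.
have Qloc c : exists2 r, 0 < r & forall y y', c - r < y -> y <= y' -> y' < c + r -> Q y y'.
  have /cvgrPdist_le/(_ e e0)[r /= r0 hr] := ch c.
  exists r => // y y' cy yy' y'c; exists [:: (h c, y'); (- h c, y)] => x.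
  have -> : combo estep [:: (h c, y'); (- h c, y)] x = h c * ivl y y' x.
    by rewrite /combo !big_cons big_nil/= -estepB//; ring.
  rewrite /ivl; split=> [yx|/negbTE ->]; last by rewrite mulr0.
  rewrite yx mulr1; apply: hr => /=; rewrite ltr_distlC.
  by move: yx => /andP[? ?]; apply/andP; lra.
pose S := [set y | a <= y <= b /\ Q a y].
have Sa : S a.
  split; first by rewrite lexx.
  have [r r0] := Qloc a; apply; lra.
have bS : ubound S b by move=> y [/andP[]].
have hS : has_sup S by split; [exists a|exists b].
have [r r0 Qr] := Qloc (sup S).
have [y Sy ry] : exists2 y, S y & sup S - r < y by apply: sup_adherent.
have supb : sup S <= b by apply: ge_sup => //; exists a.
have yS : y <= sup S by apply: ub_le_sup => //; exists b.
(* From a point of [S] just below the supremum, one local step reaches past the supremum by r / 2.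
   This contradicts maximality unless the cap b comes first. *)
have Sb : S (Num.min b (sup S + r / 2)).
  case: Sy => /andP[ay yb] Qy.
  have ym : y <= Num.min b (sup S + r / 2) by rewrite le_min yb; lra.
  split; first by rewrite (le_trans ay ym) ge_min lexx.
  apply: (Qadd _ y); [by rewrite ay| by []|].
  by apply: Qr => //; rewrite gt_min; apply/orP; right; lra.
have := ub_le_sup (ex_intro _ b bS) Sb; rewrite ge_min => /orP[bs|]; last lra.
case: Sb => _; rewrite min_l//; lra.
Qed.

(** Three successive approximations: g is truncated to [k], bounded by n and supported in [-n, n);
    [k] is replaced there by a continuous [h]; [h] is replaced by steps. The squared errors combine
    to less than 2 (e / 8) + 2 (e / 4) < e. *)
Lemma step_dense (g : R -> R) (e : R) : g \in L2r -> 0 < e ->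
  exists s, sqn (fun x => combo estep s x - g x) < e.
Proof.
move=> g2 e0.
have mg := measurable_Lfun2 g2.
(* Cuts off large values and large arguments at the same time. *)
pose tr (N : nat) x : R := ((`|g x| <= N%:R) && (- N%:R <= x < N%:R))%R%:R.
have mtr N : measurable_fun setT (tr N).
  have -> : tr N = \1_([set x | `|g x| <= N%:R] `&` `[- N%:R, N%:R[%classic).
    apply/funext => x; rewrite indicE /tr; congr (nat_of_bool _)%:R.
    apply/idP/idP; rewrite inE /= in_itv/=; first by move=> /andP[].
    by move=> -[-> ->].
  apply: measurable_indic; apply: measurableI => //.
  rewrite -[X in measurable X]setTI.
  have -> : [set x | `|g x| <= N%:R] = (Num.norm \o g) @^-1` `]-oo, N%:R].
    by apply/seteqP; split=> x; rewrite /= in_itv.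
  by apply: (measurableT_comp _ mg) => //; exact: measurableT.
have gN2 N : (fun x => g x * tr N x) \in L2r.
  apply: Lfun2_le g2 _; first exact: measurable_funM.
  by move=> x; rewrite normrM /tr; case: (_ && _); rewrite ?normr0 ?normr1 ?mulr0 ?mulr1.
have cvN : (fun N => sqn (fun x => g x * tr N x - g x)) @ \oo --> 0.
  have dN N : (fun x => g x * tr N x - g x) \in L2r by exact: Lfun2B.
  have [|||||_ _] := @dominated_convergence _ _ R mu setT measurableT
    (fun N x => ((g x * tr N x - g x) ^+ 2)%:E) (cst 0%E) (fun x => (g x * g x)%:E).
  - move=> N; apply/measurable_EFinP/measurable_funX; exact: measurable_Lfun2.
  - exact: measurable_cst.
  - apply: aeW => x _; apply: cvg_near_cst.
    apply: filterS (nbhs_infty_gtr (Num.max `|g x| `|x|)) => N.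
    rewrite gt_max => /andP[gN /ltr_normlP[xN1 xN2]].
    rewrite /tr (ltW gN) xN2 /= andbT (_ : - N%:R <= x); last by lra.
    by rewrite mulr1 subrr expr0n.
  - by case/Lfun2P: g2.
  - apply: aeW => x N _; rewrite gee0_abs ?lee_fin ?sqr_ge0//.
    rewrite /tr; case: (_ && _); rewrite ?mulr1 ?mulr0 ?subrr ?sub0r ?sqrrN ?expr2 ?mulr0 //.
    by rewrite -expr2 sqr_ge0.
  rewrite integral0 /=; under [X in X @ _]eq_fun do rewrite sqn_EFin//.
  exact: fine_cvg.
have [N N0 Ne] : exists2 N : nat, (0 < N)%N & sqn (fun x => g x * tr N x - g x) < e / 4.
  have e4 : 0 < e / 4 by lra.
  have /cvgrPdist_lt/(_ _ e4)[N _ hN] := cvN.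
  exists N.+1 => //; have := hN N.+1 (leqnSn N).
  by rewrite /= sub0r normrN; exact: le_lt_trans (ler_norm _).
have {N0} n0 : 0 < N%:R :> R by rewrite ltr0n.
pose n : R := N%:R; rewrite -/n in n0.
pose k x := g x * tr N x.
have kn x : `|k x| <= n.
  rewrite /k /tr; have [gn|_] := boolP (`|g x| <= N%:R); last by rewrite /= mulr0n mulr0 normr0 ltW.
  by case: (_ <= _ < _); rewrite /= ?mulr1n ?mulr1// ?mulr0n mulr0 normr0 ltW.
pose E : set R := `[- n, n[%classic.
have kE x : ~~ (- n <= x < n) -> k x = 0.
  by rewrite /k /tr => /negbTE ->; rewrite andbF mulr0.
have mk : measurable_fun setT k by exact: measurable_Lfun2 (gN2 N).
have mE : measurable E by exact: measurable_itv.
have muE : (mu E = (2 * n)%:E)%E.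
  rewrite /E lebesgue_measure_itv/= lte_fin ifT; last by lra.
  by rewrite -EFinB; congr EFin; lra.
have muEy : (mu E < +oo)%E by rewrite muE ltry.
have [|||h_ [ch ih hk]] := @approximation_continuous_integrable R E k.
- exact: mE.
- exact: muEy.
- apply: measurable_bounded_integrable => //.
    exact: measurable_funTS.
  exists n; split; first exact: num_real.
  by move=> y ny x _ /=; apply: le_trans (kn x) (ltW ny).
(* The constant makes 4n times this L^1 error equal to e / 16; the uniform error [d] below
   contributes 2 d^2 times the length 2n, which is e / 16 again. *)
have [m hm] : exists m, (\int[mu]_(z in E) `|(k z - h_ m z)%:E| <= (e / (64 * n))%:E)%E.
  have e64 : 0 < e / (64 * n) by rewrite divr_gt0// mulr_gt0.
  move/fine_cvgP : hk => [[M1 _ h1] /cvgrPdist_lt/(_ _ e64)[M2 _ h2]].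
  exists (M1 + M2)%N; rewrite -[leLHS]fineK; last by apply: h1 => /=; rewrite leq_addr.
  have := h2 (M1 + M2)%N (leq_addl _ _); rewrite /= sub0r normrN lee_fin => /ltW.
  exact: le_trans (ler_norm _).
(* Clamping to [-n, n] brings [h_ m] no farther from [k] and bounds the difference by 2n, which
   turns the L^1 estimate into an L^2 estimate. *)
pose h x := Num.max (- n) (Num.min n (h_ m x)).
have ch' : continuous h.
  move=> x; apply: (@continuous_max _ _ (cst (- n)) (fun x => Num.min n (h_ m x))).
    exact: cst_continuous.
  apply: (@continuous_min _ _ (cst n) (h_ m)); first exact: cst_continuous.
  exact: ch.
have hkn x : (k x - h x) ^+ 2 <= 2 * n * `|k x - h_ m x|.
  have hn : `|h x| <= n.
    by rewrite ler_norml /h le_max lexx /= ge_max ge_min lexx /=; lra.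
  have kh : `|k x - h x| <= `|k x - h_ m x|.
    have := kn x; rewrite ler_norml /h => /andP[k1 k2].
    rewrite maxEle minEle; case: (leP n (h_ m x)) => nh.
      by rewrite ifT ?ler0_norm; lra.
    by case: ifPn; rewrite -?ltNge => ?; rewrite ?lexx//; rewrite !ger0_norm; lra.
  rewrite -real_normK ?num_real// expr2 ler_pM//.
  by apply: le_trans (ler_normB _ _) _; have := kn x; lra.
pose d := Num.sqrt (e / (64 * n)).
have d0 : 0 < d by rewrite sqrtr_gt0 divr_gt0// mulr_gt0.
have d2 : d ^+ 2 = e / (64 * n) by rewrite sqr_sqrtr// divr_ge0 ?mulr_ge0// ltW.
have [|s hs] := @step_approximation h (- n) n d ch' _ d0; first by lra.
exists s.
have s2 : combo estep s \in L2r by apply: Lfun2_combo; exact: Lfun2_estep.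
apply: le_lt_trans (sqn_tri s2 g2 (gN2 N)) _.
suff : sqn (fun x => combo estep s x - k x) <= e / 8 by move: Ne; rewrite -/k; lra.
have sk2 : (fun x => combo estep s x - k x) \in L2r by exact: Lfun2B s2 (gN2 N).
rewrite -lee_fin -sqn_EFin//.
have mhk : measurable_fun E (fun x => k x - h_ m x).
  apply: measurable_funB; first exact: measurable_funTS.
  by apply: measurable_funTS; exact: continuous_measurable_fun.
apply: (@le_trans _ _ (\int[mu]_(x in E)
   ((4 * n)%:E * `|(k x - h_ m x)%:E| + (2 * d ^+ 2)%:E)))%E; last first.
  rewrite ge0_integralD//; do ?[by move=> x _; rewrite lee_fin mulr_ge0// mulr_ge0// ltW
    |by apply: measurable_funeM; apply/measurable_EFinP; exact: measurableT_comp
    |by move=> x _; rewrite lee_fin mulr_ge0// sqr_ge0].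
  rewrite ge0_integralZl//; do ?[by apply/measurable_EFinP; exact: measurableT_comp
    |by rewrite lee_fin mulr_ge0// ltW].
  rewrite integral_cst//.
  apply: (@le_trans _ _ ((4 * n)%:E * (e / (64 * n))%:E + (2 * d ^+ 2)%:E * (2 * n)%:E))%E.
    apply: leeD; last by rewrite -muE; exact: lexx.
    by apply: lee_pmul => //; rewrite ?lee_fin ?integral_ge0// mulr_ge0// ltW.
  rewrite -!EFinM -EFinD lee_fin d2 le_eqVlt; apply/orP; left; apply/eqP.
  by field; rewrite gt_eqF.
rewrite [leRHS]integral_mkcond; apply: ge0_le_integral => //.
- by move=> x _; rewrite lee_fin sqr_ge0.
- apply/measurable_EFinP/measurable_funX; exact: measurable_Lfun2 sk2.
- apply/(measurable_restrictT _ _).1 => //; apply: emeasurable_funD => //.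
  by apply: measurable_funeM; apply/measurable_EFinP; exact: measurableT_comp.
move=> x _; rewrite patchE; have [h1 h2] := hs x.
case: ifPn => [|nE].
  rewrite inE /E /= in_itv/= => /h1 sh; rewrite -EFinM -EFinD lee_fin.
  have := hkn x; have : (combo estep s x - h x) ^+ 2 <= d ^+ 2.
    by rewrite -real_normK ?num_real// ler_pXn2r// nnegrE// ltW.
  (* Writing s for the step function, this square is 2 (s - h)^2 + 2 (k - h)^2 - (s - k)^2. *)
  have := sqr_ge0 (combo estep s x + k x - 2 * h x).
  set u := `|_|; nra.
have {}nE : ~~ (- n <= x < n) by apply: contraNN nE => ?; rewrite inE /E /= in_itv.
by rewrite h2// kE// subrr expr0n.
Qed.

End steps.

(** * Real analysis: trigonometric bounds, scaling of integrals, primitives *)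

Section real_analysis.
Context {R : realType}.
Local Notation mu := (@lebesgue_measure R).

(** The form f * (f^2)^(-1) reduces the inverse to a real power of a nonnegative base, and it also
    gives the default value 0 at the zeros of f. *)
Lemma measurable_funV d (T : measurableType d) (D : set T) (f : T -> R) :
  measurable_fun D f -> measurable_fun D (fun x => (f x)^-1).
Proof.
move=> mf; rewrite (_ : (fun x => _) = (fun x => f x * (f x ^+ 2) `^ (-1))).
  apply: measurable_funM => //.
  apply: (@measurableT_comp _ _ _ _ _ _ (@powR R ^~ (-1))) => //.
  exact: measurable_funX.
apply/funext => x; rewrite powR_inv1 ?sqr_ge0//.
have [->|f0] := eqVneq (f x) 0; first by rewrite invr0 mul0r.
by rewrite expr2; field.
Qed.

Lemma norm_sin_le (x : R) : `|sin x| <= `|x|.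
Proof.
wlog x0 : x / 0 <= x => [H|].
  have [/H//|x0] := leP 0 x.
  by rewrite -normrN -sinN -[leRHS]normrN; apply: H; lra.
have [|c _] := @MVT_segment R sin cos 0 x x0.
  by apply: continuous_subspaceT => z; exact: continuous_sin.
rewrite sin0 !subr0 => ->; rewrite normrM.
by rewrite -[leRHS]mul1r ler_wpM2r// cos_max.
Qed.

Lemma one_sub_cos (x : R) : 1 - cos x = 2 * sin (x / 2) ^+ 2.
Proof.
have -> : cos x = cos (x / 2 *+ 2) by congr cos; rewrite mulr2n; lra.
by rewrite cos_mulr2n cos2sin2 mulr2n; ring.
Qed.

Lemma one_sub_cos_le (x : R) : 1 - cos x <= x ^+ 2 / 2.
Proof.
rewrite one_sub_cos.
have : sin (x / 2) ^+ 2 <= (x / 2) ^+ 2.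
  by rewrite -real_normK ?num_real// -[leRHS]real_normK ?num_real// ler_pXn2r ?nnegrE// norm_sin_le.
by rewrite expr_div_n; set a := sin _ ^+ 2; set b := x ^+ 2; lra.
Qed.

(** |a| times the push-forward of Lebesgue measure under x -> a x agrees with Lebesgue measure on
    the intervals ]c, d], hence everywhere. Both signs of a are covered because reflections are
    needed too. *)
Lemma ge0_integral_scale (a : R) (f : R -> R) : a != 0 ->
  measurable_fun setT f -> (forall x, 0 <= f x) ->
  (\int[mu]_x (f x)%:E = `|a|%:E * \int[mu]_x (f (a * x))%:E)%E.
Proof.
move=> a0 mf f0.
have na : 0 <= `|a| by [].
have ma : measurable_fun setT (fun x : measurableTypeR R => (a * x : measurableTypeR R)).
  exact: measurable_funM.
pose m := mscale (NngNum na) (pushforward mu (fun x : measurableTypeR R => (a * x : measurableTypeR R))).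
have mE (A : set (measurableTypeR R)) : measurable A -> mu A = m ma A.
  apply: lebesgue_measure_unique => _ [[c d]] _ <-.
  change (mu `]c, d]%classic = `|a|%:E * mu [set x : R | `]c, d]%classic (a * x)%R])%E.
  have [a1|a1] := ltP 0 a.
    have -> : [set x | `]c, d]%classic (a * x)] = `]c / a, d / a]%classic.
      apply/seteqP; split=> x; rewrite /= !in_itv/= ltr_pdivrMr// ler_pdivlMr//;
        by rewrite mulrC.
    rewrite !lebesgue_measure_itv/= !lte_fin ltr_pM2r ?invr_gt0//.
    case: ifPn => _; last by rewrite mule0.
    by rewrite -!EFinB -EFinM gtr0_norm//; congr EFin; field.
  have {}a1 : a < 0 by rewrite lt_neqAle a0.
  (* For a < 0 the preimage is half-open on the other side, with the same length. *)
  have -> : [set x | `]c, d]%classic (a * x)] = `[d / a, c / a[%classic.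
    apply/seteqP; split=> x; rewrite /= !in_itv/= ltr_ndivlMr// ler_ndivrMr//;
      by rewrite andbC mulrC.
  rewrite !lebesgue_measure_itv/= !lte_fin ltr_nM2r ?invr_lt0//.
  case: ifPn => _; last by rewrite mule0.
  by rewrite -!EFinB -EFinM ltr0_norm//; congr EFin; field.
transitivity (\int[m ma]_x (f x)%:E)%E.
  by apply: eq_measure_integral => A mA _; exact: mE.
rewrite ge0_integral_mscale//=; last 2 first.
- by apply/measurable_EFinP.
- by move=> x _; rewrite lee_fin.
rewrite ge0_integral_pushforward//=; first exact/measurable_EFinP.
by move=> x _; rewrite lee_fin.
Qed.

Lemma ge0_integral_opp (f : R -> R) :
  measurable_fun setT f -> (forall x, 0 <= f x) ->
  (\int[mu]_x (f x)%:E = \int[mu]_x (f (- x))%:E)%E.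
Proof.
move=> mf f0; rewrite (@ge0_integral_scale (-1))// ?oppr_eq0 ?oner_eq0//.
by rewrite normrN1 mul1e; apply: eq_integral => x _; rewrite mulN1r.
Qed.

(** The integral over [0, +oo[ is known; reflected onto ]-oo, 0], it dominates the one over the
    complement. *)
Lemma integral_oneDsqr_lty : (\int[mu]_x ((1 + x ^+ 2)^-1)%:E < +oo)%E.
Proof.
have m1 : measurable_fun setT (fun x : R => ((1 + x ^+ 2)^-1)%:E).
  apply/measurable_EFinP; apply: measurable_funV; apply: measurable_funD => //.
rewrite -(setUv `[0, +oo[%classic) ge0_integral_setU//=; last 4 first.
- exact: measurableC.
- by move: m1; rewrite setUv.
- by move=> x _; rewrite lee_fin invr_ge0 addr_ge0 ?sqr_ge0.
- exact/disj_setPCl.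
have H : (\int[mu]_(x in `[0%R, +oo[) ((1 + x ^+ 2)^-1)%:E < +oo)%E.
  by rewrite (integral0y_oneDsqr R) ltry.
rewrite lte_add_pinfty//; apply: le_lt_trans H.
rewrite ge0_integration_by_substitution0//=; last first.
  by move=> r; rewrite lee_fin invr_ge0 addr_ge0 ?sqr_ge0.
under [leRHS]eq_integral do rewrite sqrrN.
apply: ge0_subset_integral => //=.
- exact: measurableC.
- exact: measurable_funTS.
- by move=> x _; rewrite lee_fin invr_ge0 addr_ge0 ?sqr_ge0.
- by move=> x /=; rewrite !in_itv/= andbT => /negP; rewrite -ltNge => /ltW.
Qed.

Lemma Rintegral_ivl (f F : R -> R) (a b : R) : a <= b -> continuous f ->
  (forall x, is_derive x (1 : R) F (f x)) ->
  mu.-integrable setT (EFin \o (fun x => ivl a b x * f x)) /\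
  \int[mu]_x (ivl a b x * f x) = F b - F a.
Proof.
move=> ab cf dF.
have E : (fun x => ivl a b x * f x) = f \_ `[a, b[.
  apply/funext => x; rewrite patchE ivlE indicE.
  by case: ifP => _; rewrite ?mul1r ?mul0r.
have mf : measurable_fun setT f by exact: continuous_measurable_fun.
have intf : mu.-integrable `[a, b] (EFin \o f).
  by apply: continuous_compact_integrable => //; [exact: segment_compact|exact: continuous_subspaceT].
have sab : `[a, b[ `<=` `[a, b]%classic.
  by move=> x; rewrite /= !in_itv/= => /andP[-> /ltW].
split.
  rewrite E -restrict_EFin; apply/(integrable_mkcond _ _).1 => //.
  by apply: (integrableS _ _ _ intf) => //.
rewrite E -Rintegral_mkcond Rintegral_itv_bndo_bndc; last first.
  by apply: (integrableS _ _ _ intf) => //.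
move: ab; rewrite le_eqVlt => /predU1P[->|ab].
  by rewrite set_itv1 Rintegral_set1 subrr.
rewrite /Rintegral (continuous_FTC2 ab _ (F := F))//.
- exact: continuous_subspaceT.
- have cF : continuous F.
    by move=> x; apply/differentiable_continuous/derivable1_diffP; case: (dF x).
  split.
  + by move=> x _; case: (dF x).
  + by apply: cvg_at_right_filter; exact: cF.
  + by apply: cvg_at_left_filter; exact: cF.
- by move=> x _; rewrite derive1E; have [_ ->] := dF x.
Qed.

(** The sign convention of [estep] is the one that makes a single formula valid for both signs of
    a. *)
Lemma Rintegral_estep (f F : R -> R) (a : R) : continuous f ->
  (forall x, is_derive x (1 : R) F (f x)) ->
  mu.-integrable setT (EFin \o (fun x => estep a x * f x)) /\
  \int[mu]_x (estep a x * f x) = F a - F 0.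
Proof.
move=> cf dF; have [a0|a0] := leP 0 a.
  have -> : estep a = ivl 0 a.
    apply/funext => x; rewrite -(estepB x a0) /estep subrr subr0//.
  exact: Rintegral_ivl.
have a0' := ltW a0.
have [i1 i2] := Rintegral_ivl a0' cf dF.
have E : (fun x => estep a x * f x) = (fun x => - 1 * (ivl a 0 x * f x)).
  apply/funext => x; have := estepB x a0'; rewrite {1}/estep subrr sub0r => <-.
  by rewrite mulN1r mulNr opprK.
rewrite E; split.
  rewrite (_ : _ \o _ = (fun x => (- 1)%:E * (ivl a 0 x * f x)%:E)%E)//.
  exact: integrableZl.
by rewrite RintegralZl// i2; ring.
Qed.

End real_analysis.

(** * Hartley transform *)

Section hartley_steps.
Context {R : realType}.
Local Notation mu := (@lebesgue_measure R).
Local Notation L2r := (Lfun mu 2%:E).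

(** Discards the frequency 0, where quotients by k take default values. *)
Lemma ae_neq0 : {ae mu, forall x : R, x != 0}.
Proof.
exists [set 0]; split => //; first exact: lebesgue_measure_set1.
by move=> x /= /negP; rewrite negbK => /eqP.
Qed.

(* The cosine, sine and Hartley transforms of [estep a] at [k != 0]; at [k = 0]
   the division by zero gives 0 instead of [a] for the first and the last. *)
Definition cstep (a k : R) : R := sin (k * a) / k.
Definition sstep (a k : R) : R := (1 - cos (k * a)) / k.
Definition hstep (a k : R) : R := cstep a k + sstep a k.

Lemma continuous_comp_mul (f : R -> R) (k : R) : continuous f ->
  continuous (fun x => f (k * x)).
Proof.
move=> cf x; apply: (@continuous_comp _ _ _ (fun x => k * x) f); last exact: cf.
exact: mulrl_continuous.
Qed.

Lemma Rintegral_estep_cos (a k : R) : k != 0 ->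
  mu.-integrable setT (EFin \o (fun x => estep a x * cos (k * x))) /\
  \int[mu]_x (estep a x * cos (k * x)) = cstep a k.
Proof.
move=> k0.
have := @Rintegral_estep R (fun x => cos (k * x)) (fun x => sin (k * x) / k) a.
rewrite !mulr0 sin0 mul0r subr0; apply.
  exact/continuous_comp_mul/continuous_cos.
move=> x; have H : is_derive x (1:R) (fun x => k * x) k.
  by apply: is_derive_eq; rewrite ?scaler0 ?add0r /GRing.scale/= ?mulr1 ?mulr0 ?addr0 ?add0r.
have H2 : is_derive x (1:R) (sin \o (fun x => k * x)) (cos (k * x) * k).
  exact: is_derive1_comp.
have -> : (fun x => sin (k * x) / k) = (fun x => k^-1 *: (sin \o (fun x => k * x)) x).
  by apply/funext => y /=; rewrite mulrC.
by apply: is_derive_eq; rewrite /GRing.scale/=; field.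
Qed.

Lemma Rintegral_estep_sin (a k : R) : k != 0 ->
  mu.-integrable setT (EFin \o (fun x => estep a x * sin (k * x))) /\
  \int[mu]_x (estep a x * sin (k * x)) = sstep a k.
Proof.
move=> k0.
have := @Rintegral_estep R (fun x => sin (k * x)) (fun x => - cos (k * x) / k) a.
have -> : - cos (k * a) / k - - cos (k * 0) / k = sstep a k.
  by rewrite mulr0 cos0 /sstep; ring.
apply; first exact/continuous_comp_mul/continuous_sin.
move=> x; have H : is_derive x (1:R) (fun x => k * x) k.
  by apply: is_derive_eq; rewrite ?scaler0 ?add0r /GRing.scale/= ?mulr1 ?mulr0 ?addr0 ?add0r.
have H2 : is_derive x (1:R) (cos \o (fun x => k * x)) (- sin (k * x) * k).
  exact: is_derive1_comp.
have -> : (fun x => - cos (k * x) / k) = (fun x => (- k^-1) *: (cos \o (fun x => k * x)) x).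
  by apply/funext => y /=; rewrite /GRing.scale/=; ring.
by apply: is_derive_eq; rewrite /GRing.scale/=; field.
Qed.

Lemma measurable_cstep a : measurable_fun setT (cstep a).
Proof.
apply: measurable_funM; last exact: measurable_funV.
apply: (@measurableT_comp _ _ _ _ _ _ sin); last exact: measurable_funM.
exact: continuous_measurable_fun (@continuous_sin R).
Qed.

Lemma measurable_sstep a : measurable_fun setT (sstep a).
Proof.
apply: measurable_funM; last exact: measurable_funV.
apply: measurable_funB => //.
apply: (@measurableT_comp _ _ _ _ _ _ cos); last exact: measurable_funM.
exact: continuous_measurable_fun (@continuous_cos R).
Qed.

Lemma measurable_hstep a : measurable_fun setT (hstep a).
Proof. by apply: measurable_funD; [exact: measurable_cstep|exact: measurable_sstep]. Qed.

(** [cstep a] is even and [sstep a] is odd, also at 0 thanks to the default value. Reflection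
    therefore separates the two. *)
Lemma hstepN a k : hstep a (- k) = cstep a k - sstep a k.
Proof.
rewrite /hstep /cstep /sstep mulNr sinN cosN; have [->|k0] := eqVneq k 0.
  by rewrite oppr0 invr0 !mulr0 addr0 subr0.
by field.
Qed.

Lemma hstep0 k : hstep 0 k = 0.
Proof. by rewrite /hstep /cstep /sstep mulr0 sin0 cos0 subrr !mul0r addr0. Qed.

(** The function |e^{ikd} - 1|^2 / k^2: the squared modulus of the Fourier transform of an interval
    of length |d|, with value 0 at k = 0. *)
Definition vstep (d k : R) : R := 2 * (1 - cos (k * d)) / k ^+ 2.

Lemma vstep_ge0 d k : 0 <= vstep d k.
Proof. by rewrite mulr_ge0 ?invr_ge0 ?sqr_ge0// mulr_ge0// subr_ge0 cos_le1. Qed.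

Lemma measurable_vstep d : measurable_fun setT (vstep d).
Proof.
apply: measurable_funM; last by apply: measurable_funV; exact: measurable_funX.
apply: measurable_funM => //; apply: measurable_funB => //.
apply: (@measurableT_comp _ _ _ _ _ _ cos); last exact: measurable_funM.
exact: continuous_measurable_fun (@continuous_cos R).
Qed.

(** With c and s the increments of the cosine and sine transforms, the left side is (c + s)^2 + (c -
    s)^2 = 2 (c^2 + s^2): adding the reflection removes the cross term. *)
Lemma hstepB_sqr a b k :
  (hstep a k - hstep b k) ^+ 2 + (hstep a (- k) - hstep b (- k)) ^+ 2
  = 2 * vstep (a - b) k.
Proof.
rewrite !hstepN /hstep /cstep /sstep /vstep [k * (a - b)]mulrBr cosB.
have [->|k0] := eqVneq k 0; first by rewrite invr0 !mulr0 expr0n /= invr0 !mulr0; ring.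
have ha := cos2Dsin2 (k * a); have hb := cos2Dsin2 (k * b).
apply/eqP; rewrite -subr_eq0; apply/eqP.
transitivity (2 * (cos (k * a) ^+ 2 + sin (k * a) ^+ 2 +
  (cos (k * b) ^+ 2 + sin (k * b) ^+ 2) - 2) / k ^+ 2).
  by field.
by rewrite ha hb; field.
Qed.

(** This number is 2 pi, the constant of Parseval's formula for the unnormalized transform. *)
Definition hartley_cst : R := fine (\int[mu]_k (vstep 1 k)%:E).

Lemma integral_vstep1 : (\int[mu]_k (vstep 1 k)%:E)%E = hartley_cst%:E.
Proof.
rewrite fineK// ge0_fin_numE; last by apply: integral_ge0 => k _; rewrite lee_fin vstep_ge0.
(* Since 2 (1 - cos k) is at most k^2 and at most 4, its product with 1 + k^2 is at most k^2 + 4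
   k^2. *)
apply: (@le_lt_trans _ _ (5%:E * \int[mu]_x ((1 + x ^+ 2)^-1)%:E))%E; last first.
  by rewrite lte_mul_pinfty// integral_oneDsqr_lty.
have m1 : measurable_fun setT (fun x : R => (1 + x ^+ 2)^-1).
  by apply: measurable_funV; apply: measurable_funD.
rewrite -ge0_integralZl//=; last 2 first.
- exact/measurable_EFinP.
- by move=> x _; rewrite lee_fin invr_ge0 addr_ge0 ?sqr_ge0.
apply: ge0_le_integral => //.
- by move=> x _; rewrite lee_fin vstep_ge0.
- by apply/measurable_EFinP; exact: measurable_vstep.
- by apply: measurable_funeM; exact/measurable_EFinP.
move=> k _; rewrite -EFinM lee_fin /vstep mulr1.
have p1 : 0 < 1 + k ^+ 2 by rewrite ltr_pwDl// sqr_ge0.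
have [->|k0] := eqVneq k 0; first by rewrite expr0n invr0 mulr0 addr0 invr1.
have k2 : 0 < k ^+ 2 by rewrite exprn_even_gt0.
rewrite ler_pdivrMr// mulrAC ler_pdivlMr//.
have := one_sub_cos_le k; have := cos_geN1 k; have := cos_le1 k.
by move: k2; set y := k ^+ 2; nra.
Qed.

(** Homogeneity, [vstep d k] = d^2 [vstep 1 (d * k)], gives a factor d^2 and the change of variable
    divides it by |d|. *)
Lemma integral_vstep d : (\int[mu]_k (vstep d k)%:E = (hartley_cst * `|d|)%:E)%E.
Proof.
have [->|d0] := eqVneq d 0.
  rewrite normr0 mulr0 -[RHS](integral0 mu setT); apply: eq_integral => k _.
  by rewrite /vstep mulr0 cos0 subrr mulr0 mul0r.
have v0 := vstep_ge0 1; have mv := measurable_vstep 1.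
rewrite EFinM -integral_vstep1 (ge0_integral_scale d0 mv v0).
rewrite muleC muleA -EFinM -ge0_integralZl//=; do ?[by move=> x _; rewrite lee_fin
  |by apply/measurable_EFinP; apply: (@measurableT_comp _ _ _ _ _ _ (vstep 1)) => //;
    exact: measurable_funM].
apply: eq_integral => k _; rewrite -EFinM -expr2 real_normK ?num_real//; congr EFin.
rewrite /vstep mulr1 (mulrC d k); have [->|k0] := eqVneq k 0.
  by rewrite mul0r expr0n /= invr0 !mulr0.
by field; rewrite k0 d0.
Qed.

Lemma hartley_cst_gt0 : 0 < hartley_cst.
Proof.
have v0 := vstep_ge0 1; have mv := measurable_vstep 1.
rewrite lt_neqAle; apply/andP; split; last first.
  by rewrite fine_ge0// integral_ge0// => k _; rewrite lee_fin.
apply/negP => /eqP c0.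
have : (\int[mu]_k `|(vstep 1 k)%:E| = 0)%E.
  rewrite [LHS](_ : _ = hartley_cst%:E) -?c0// c0 -integral_vstep1.
  by apply: eq_integral => k _; rewrite gee0_abs// lee_fin.
move/(ae_eq_integral_abs _ measurableT _).1 => /(_ _)[]; first exact/measurable_EFinP.
move=> N [mN N0 sN].
(* On this interval the sine is positive, so the cosine is not 1 and [vstep 1] does not vanish; an
   interval of length 2 would thus lie in a null set. *)
have : (mu `]0%R, 2%R[ <= 0)%E.
  rewrite -N0; apply: le_measure; rewrite ?inE//.
  move=> x /=; rewrite in_itv/= => x02; apply: sN => /= /(_ I) [] /eqP.
  have /andP[x0 _] := x02.
  rewrite /vstep mulr1 mulf_eq0 invr_eq0 expf_eq0/= (gt_eqF x0) orbF.
  rewrite mulf_eq0 pnatr_eq0/= subr_eq0 => /eqP cx.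
  have := sin2_gt0 x02; have := cos2Dsin2 x; rewrite -cx; nra.
by rewrite lebesgue_measure_itv/= lte_fin ltr0n/= oppr0 adde0 lee_fin lern0.
Qed.

Lemma integral_hstepB a b :
  (\int[mu]_k ((hstep a k - hstep b k) ^+ 2)%:E = (hartley_cst * `|a - b|)%:E)%E.
Proof.
pose g k := (hstep a k - hstep b k) ^+ 2.
have mg : measurable_fun setT g.
  by apply: measurable_funX; apply: measurable_funB; exact: measurable_hstep.
have mgN : measurable_fun setT (fun k : R => g (- k)).
  by apply: (@measurableT_comp _ _ _ _ _ _ g).
have g0 k : 0 <= g k by exact: sqr_ge0.
have : (\int[mu]_k (g k)%:E + \int[mu]_k (g k)%:E = (2 * (hartley_cst * `|a - b|))%:E)%E.
  rewrite {2}(ge0_integral_opp mg g0) -ge0_integralD//=; do ?[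
    by move=> k _; rewrite lee_fin|exact/measurable_EFinP].
  rewrite EFinM -integral_vstep -ge0_integralZl//=; do ?[
    by move=> k _; rewrite lee_fin vstep_ge0|by apply/measurable_EFinP; exact: measurable_vstep].
  by apply: eq_integral => k _; rewrite -EFinD -EFinM hstepB_sqr.
rewrite -/(g _); have : (0 <= \int[mu]_k (g k)%:E)%E.
  by apply: integral_ge0 => k _; rewrite lee_fin.
case: (\int[mu]_k (g k)%:E)%E => [r| |]// _; rewrite -EFinD => -[] rr; congr EFin; lra.
Qed.

Lemma Lfun2_hstepB a b : (fun k => hstep a k - hstep b k) \in L2r.
Proof.
have m : measurable_fun setT (fun k => hstep a k - hstep b k).
  by apply: measurable_funB; exact: measurable_hstep.
apply/Lfun2P; split => //; apply/integrableP; split.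
  by apply/measurable_EFinP; exact: measurable_funM.
apply: le_lt_trans (ltry (hartley_cst * `|a - b|)); rewrite -integral_hstepB.
rewrite le_eqVlt; apply/orP; left; apply/eqP; apply: eq_integral => k _ /=.
by rewrite -expr2 ger0_norm// sqr_ge0.
Qed.

Lemma Lfun2_hstep a : hstep a \in L2r.
Proof.
rewrite (_ : hstep a = fun k => hstep a k - hstep 0 k); first exact: Lfun2_hstepB.
by apply/funext => k; rewrite hstep0 subr0.
Qed.

Lemma sqn_hstepB a b : sqn (fun k => hstep a k - hstep b k) = hartley_cst * `|a - b|.
Proof. by have [] := sqn_EFin (Lfun2_hstepB a b); rewrite integral_hstepB => -[]. Qed.

(* Polarization: both Gram matrices are those of a two-sided Brownian motion. *)
Lemma dot_hstep a b : dot (hstep a) (hstep b) = hartley_cst * dot (estep a) (estep b).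
Proof.
have e0 : (estep 0 : R -> R) = fun=> 0 by apply/funext => x; rewrite /estep subrr.
have eL (E : R -> R -> R) (C : R) : (forall a, E a \in L2r) -> E 0 = (fun=> 0) ->
    (forall a b, sqn (fun k => E a k - E b k) = C * `|a - b|) ->
    2 * dot (E a) (E b) = C * (`|a| + `|b| - `|a - b|).
  move=> E2 E0 EB.
  have sE c : sqn (E c) = C * `|c|.
    by rewrite -[X in `|X|]subr0 -EB E0; congr sqn; apply/funext => k; rewrite subr0.
  by have := EB a b; rewrite sqnB// !sE; nra.
have := eL hstep hartley_cst Lfun2_hstep (funext hstep0) sqn_hstepB.
have H1 : forall a b : R, sqn (fun k => estep a k - estep b k) = 1 * `|a - b|.
  by move=> x y; rewrite sqn_estepB mul1r.
have := eL estep 1 Lfun2_estep e0 H1; rewrite mul1r; nra.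
Qed.

(** Both sides are iterated integrals of [K], whose kernel cos(xy) + sin(xy) is symmetric. Fubini
    applies because the kernel is bounded by 2 and steps are integrable; the inner integrals are
    [hstep] values only off the null set {0}. *)
Lemma dot_hstep_estep a b : dot (hstep a) (estep b) = dot (estep a) (hstep b).
Proof.
pose K (p : R * R) : R := estep a p.1 * (estep b p.2 * (cos (p.1 * p.2) + sin (p.1 * p.2))).
have m1 : measurable_fun setT (fun p : R * R => estep a p.1).
  by apply: (@measurableT_comp _ _ _ _ _ _ (estep a)) => //; exact: measurable_Lfun2 (Lfun2_estep a).
have m2 : measurable_fun setT (fun p : R * R => estep b p.2).
  by apply: (@measurableT_comp _ _ _ _ _ _ (estep b)) => //; exact: measurable_Lfun2 (Lfun2_estep b).
have mp : measurable_fun setT (fun p : R * R => p.1 * p.2) by exact: measurable_funM.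
have mK : measurable_fun setT K.
  apply: measurable_funM => //; apply: measurable_funM => //; apply: measurable_funD.
    apply: (@measurableT_comp _ _ _ _ _ _ cos) => //.
    exact: continuous_measurable_fun (@continuous_cos R).
  apply: (@measurableT_comp _ _ _ _ _ _ sin) => //.
  exact: continuous_measurable_fun (@continuous_sin R).
have ih c x : x != 0 ->
    mu.-integrable setT (EFin \o (fun y => estep c y * (cos (x * y) + sin (x * y)))) /\
    \int[mu]_y (estep c y * (cos (x * y) + sin (x * y))) = hstep c x.
  move=> x0; have [c1 c2] := Rintegral_estep_cos c x0; have [s1 s2] := Rintegral_estep_sin c x0.
  split.
    rewrite (_ : _ \o _ = (fun y => (estep c y * cos (x * y))%:E + (estep c y * sin (x * y))%:E)%E).
      exact: integrableD.
    by apply/funext => y; rewrite /= mulrDr EFinD.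
  by rewrite /hstep -c2 -s2 -RintegralD//; apply: eq_Rintegral => y _; rewrite mulrDr.
have iK : (mu \x mu)%E.-integrable setT (EFin \o K).
  apply/integrable12ltyP; first exact/measurable_EFinP.
  have /integrableP[_ ia] := integrable_estep a; have /integrableP[_ ib] := integrable_estep b.
  have mb : measurable_fun setT (fun y => (2 * `|estep b y|)%:E).
    apply/measurable_EFinP; apply: measurable_funM => //; apply: measurableT_comp => //.
    exact: measurable_Lfun2 (Lfun2_estep b).
  have ma : measurable_fun setT (fun y => `|estep a y|%:E).
    apply/measurable_EFinP; apply: measurableT_comp => //.
    exact: measurable_Lfun2 (Lfun2_estep a).
  apply: (@le_lt_trans _ _ (\int[mu]_x (`|estep a x|%:E * \int[mu]_y (2 * `|estep b y|)%:E)))%E.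
    apply: ge0_le_integral => //.
    - by move=> x _; apply: integral_ge0.
    - have := @measurable_fun_fubini_tonelli_F _ _ _ _ R mu (fun p => `|(K p)%:E|%E).
      apply => //; by apply/measurableT_comp => //; exact/measurable_EFinP.
    - by apply: emeasurable_funM => //.
    move=> x _; rewrite -ge0_integralZl//.
    apply: ge0_le_integral => //; do ?[
      by apply/measurableT_comp => //; apply/measurable_EFinP;
         exact: (measurableT_comp mK (pair1_measurable x))
     |exact: measurable_funeM].
    move=> y _; rewrite /= -EFinM lee_fin /K /= !normrM ler_wpM2l// mulrC ler_wpM2r//.
    by apply: le_trans (ler_normD _ _) _; have := cos_max (x * y); have := sin_max (x * y); lra.
  rewrite ge0_integralZr//=; last by apply: integral_ge0 => y _; rewrite lee_fin mulr_ge0.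
  under [X in (_ * X)%E]eq_integral do rewrite EFinM.
  rewrite [X in (_ * X)%E]ge0_integralZl//=; last by apply/measurable_EFinP;
    apply: measurableT_comp => //; exact: measurable_Lfun2 (Lfun2_estep b).
  by rewrite lte_mul_pinfty ?integral_ge0// ?ge0_fin_numE ?integral_ge0// lte_mul_pinfty.
have := Fubini iK.
rewrite [X in X = _](_ : _ = \int[mu]_x (estep a x * hstep b x)%:E)%E; last first.
  apply: ae_eq_integral => //.
  - exact: (measurable_fubini_F iK).
  - by apply/measurable_EFinP/measurable_funM; [exact: measurable_Lfun2 (Lfun2_estep a)|
    exact: measurable_hstep].
  move: ae_neq0; apply: (@filterS _ _ (ae_filter_ringOfSetsType mu)) => x x0 _.
  have [h1 h2] := ih b x x0.
  by rewrite /K /= -h2 /Rintegral EFinM fineK ?integrable_fin_num// -integralZl.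
rewrite [X in _ = X -> _](_ : _ = \int[mu]_x (hstep a x * estep b x)%:E)%E; last first.
  apply: ae_eq_integral => //.
  - exact: (measurable_fubini_G iK).
  - by apply/measurable_EFinP/measurable_funM; [exact: measurable_hstep|
    exact: measurable_Lfun2 (Lfun2_estep b)].
  move: ae_neq0; apply: (@filterS _ _ (ae_filter_ringOfSetsType mu)) => x x0 _.
  have [h1 h2] := ih a x x0.
  rewrite /K /= -h2 /Rintegral mulrC EFinM fineK ?integrable_fin_num// -integralZl//.
  by apply: eq_integral => y _; rewrite -EFinM (mulrC x y); congr EFin; ring.
by rewrite /dot /Rintegral => ->.
Qed.

End hartley_steps.

(** * Extension of the Hartley transform to L^2 *)

Section hartley.
Context {R : realType}.
Local Notation mu := (@lebesgue_measure R).
Local Notation L2r := (Lfun mu 2%:E).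
Local Notation C := (@hartley_cst R).
Implicit Types (s t : seq (R * R)) (p q P Q : R -> R).

(** Stated for two abstract families so as to serve in both directions: it produces the transform of
    a given function and, with the families exchanged and K = 1 / C, the function with a given
    transform. *)
Lemma combo_limit (E F : R -> R -> R) (K : R) (g : R -> R) :
  (forall a, E a \in L2r) -> (forall a, F a \in L2r) -> g \in L2r -> 0 <= K ->
  (forall s, sqn (combo F s) = K * sqn (combo E s)) ->
  (forall e, 0 < e -> exists s, sqn (fun x => combo E s x - g x) < e) ->
  exists2 G, G \in L2r & exists s_ : nat -> seq (R * R),
    (fun n => sqn (fun x => combo E (s_ n) x - g x)) @ \oo --> 0 /\
    (fun n => sqn (fun x => combo F (s_ n) x - G x)) @ \oo --> 0.
Proof.
move=> E2 F2 g2 K0 EF dE.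
have cE2 s : combo E s \in L2r by exact: Lfun2_combo.
have cF2 s : combo F s \in L2r by exact: Lfun2_combo.
(* Consecutive approximants differ by at most 4 eta n in squared norm; after multiplication by K
   this is at most 1 / 8^n, the rate [Lfun2_complete_fast] asks for. K + 1 keeps the denominator
   positive when K = 0. *)
pose eta n : R := (8 ^+ n)^-1 / (4 * (K + 1)).
have K1 : 0 < 4 * (K + 1) by lra.
have eta0 n : 0 < eta n by rewrite divr_gt0// invr_gt0 exprn_gt0.
have /choice[s_ hs] n := dE _ (eta0 n).
have [||G G2 hG] := @Lfun2_complete_fast R (fun n => combo F (s_ n)).
- by move=> n.
- move=> n; rewrite -combo_sub EF combo_sub.
  have : sqn (fun x => combo E (s_ n.+1) x - combo E (s_ n) x) <= 4 * eta n.
    apply: le_trans (sqn_tri (cE2 _) (cE2 _) g2) _.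
    rewrite [X in _ + 2 * X]sqnBC; have := hs n; have := hs n.+1.
    have : eta n.+1 <= eta n.
      rewrite /eta ler_pM2r ?invr_gt0// lef_pV2 ?posrE ?exprn_gt0//.
      by rewrite ler_eXn2l// ltr1n.
    lra.
  move=> /(ler_wpM2l K0) /le_trans; apply.
  rewrite /eta div1r; have : 0 < (8 ^+ n : R)^-1 by rewrite invr_gt0 exprn_gt0.
  set y := _^-1 => y0; rewrite (_ : K * _ = y * (K / (K + 1))).
    rewrite -[leRHS]mulr1 ler_wpM2l ?(ltW y0)// ler_pdivrMr; lra.
  by field; rewrite gt_eqF//; lra.
exists G => //; exists s_; split => //.
apply: (@squeeze_cvgr _ _ _ _ (fun=> 0) eta).
- by apply: nearW => n; rewrite sqn_ge0 ltW.
- exact: cvg_cst.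
rewrite -[X in _ --> X](mul0r (4 * (K + 1))^-1); apply: cvgMl.
have : (fun n => (8^-1 : R) ^+ n) @ \oo --> 0.
  by apply: cvg_expr; rewrite ger0_norm ?invr_ge0// invf_lt1// ltr1n.
by apply: cvg_trans; apply: near_eq_cvg; apply: nearW => n; rewrite exprVn.
Qed.

Lemma sqn_combo_hstep s : sqn (combo hstep s) = C * sqn (combo estep s).
Proof.
by apply: sqn_combo; [exact: Lfun2_estep|exact: Lfun2_hstep|exact: dot_hstep].
Qed.

Lemma Lfun2_combo_estep s : combo (@estep R) s \in L2r.
Proof. by apply: Lfun2_combo; exact: Lfun2_estep. Qed.

Lemma Lfun2_combo_hstep s : combo (@hstep R) s \in L2r.
Proof. by apply: Lfun2_combo; exact: Lfun2_hstep. Qed.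

Lemma dot_combo_hstep s t :
  dot (combo hstep s) (combo estep t) = dot (combo estep s) (combo hstep t).
Proof.
rewrite !dot_combo; try exact: Lfun2_estep; try exact: Lfun2_hstep.
by apply: eq_bigr => p _; apply: eq_bigr => q _; rewrite dot_hstep_estep.
Qed.

(* With U the transform on steps, |U s|^2 = C |s|^2 and <U s, t> = <s, U t>
   give |U s - t|^2 = C |s - U t / C|^2, so density of steps passes to
   density of their transforms. *)
Lemma hstep_dense P (e : R) : P \in L2r -> 0 < e ->
  exists s, sqn (fun x => combo hstep s x - P x) < e.
Proof.
move=> P2 e0; have C0 := @hartley_cst_gt0 R.
have cE2 := Lfun2_combo_estep; have cF2 := Lfun2_combo_hstep.
have [t ht] : exists t, sqn (fun x => combo estep t x - P x) < e / 4.
  by apply: step_dense => //; lra.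
have g2 : (fun x => C^-1 * combo hstep t x) \in L2r by exact: Lfun2Z.
have [|s hs] := @step_dense R _ (e / (4 * C)) g2; first by rewrite divr_gt0// mulr_gt0.
exists s; apply: le_lt_trans (sqn_tri (cF2 s) P2 (cE2 t)) _.
have : C * sqn (fun x => combo estep s x - C^-1 * combo hstep t x) < e / 4.
  rewrite mulrC -ltr_pdivlMr//; apply: lt_le_trans hs _.
  by rewrite le_eqVlt; apply/orP; left; apply/eqP; field; rewrite gt_eqF.
have -> : C * sqn (fun x => combo estep s x - C^-1 * combo hstep t x) =
    sqn (fun x => combo hstep s x - combo estep t x).
  rewrite !sqnB// dotZr// sqnZ// !sqn_combo_hstep dot_combo_hstep.
  by field; rewrite gt_eqF.
lra.
Qed.

(** The closure in L^2 x L^2 of the graph of the transform on steps. A relation suits functions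
    determined only almost everywhere and treats both directions alike. *)
Definition hartley_pair p P :=
  [/\ p \in L2r, P \in L2r & exists s_ : nat -> seq (R * R),
    (fun n => sqn (fun x => combo estep (s_ n) x - p x)) @ \oo --> 0 /\
    (fun n => sqn (fun x => combo hstep (s_ n) x - P x)) @ \oo --> 0].

Lemma hartley_pair_ex p : p \in L2r -> exists P, hartley_pair p P.
Proof.
move=> p2.
have [P P2 [s_ [h1 h2]]] := combo_limit (@Lfun2_estep R) (@Lfun2_hstep R) p2
  (ltW (@hartley_cst_gt0 R)) sqn_combo_hstep (fun e => step_dense p2).
by exists P; split => //; exists s_.
Qed.

Lemma hartley_pair_onto P : P \in L2r -> exists p, hartley_pair p P.
Proof.
move=> P2; have C0 := @hartley_cst_gt0 R.
have K0 : 0 <= C^-1 by rewrite invr_ge0 ltW.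
have H s : sqn (combo estep s) = C^-1 * sqn (combo hstep s).
  by rewrite sqn_combo_hstep mulKf// gt_eqF.
have [p p2 [s_ [h1 h2]]] := combo_limit (@Lfun2_hstep R) (@Lfun2_estep R) P2
  K0 H (fun e => hstep_dense P2).
by exists p; split => //; exists s_.
Qed.

Lemma hartley_pair_combo s : hartley_pair (combo estep s) (combo hstep s).
Proof.
split; [exact: Lfun2_combo_estep|exact: Lfun2_combo_hstep|exists (fun=> s)].
have z (f : R -> R) : sqn (fun x => f x - f x) = 0.
  by rewrite -(dot0l (fun=> 0)); congr dot; apply/funext => x; rewrite subrr.
by rewrite !z; split; exact: cvg_cst.
Qed.

(** The exact constant is 1 / C; the factor 4 comes from two uses of [sqnD_le], one to compare p
    with a step function and one to compare its transform with P. *)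
Lemma hartley_pair_sqn_le p P : hartley_pair p P -> sqn p <= 4 / C * sqn P.
Proof.
move=> [p2 P2 [s_ [h1 h2]]]; have C0 := @hartley_cst_gt0 R.
have cE2 := Lfun2_combo_estep; have cF2 := Lfun2_combo_hstep.
apply/ler_addgt0Pr => e e0.
have e4 : 0 < e / 4 by lra.
have e8 : 0 < e * C / 8 by rewrite divr_gt0// mulr_gt0.
have /cvgrPdist_lt/(_ _ e4)[N1 _ H1] := h1.
have /cvgrPdist_lt/(_ _ e8)[N2 _ H2] := h2.
have := H1 (N1 + N2)%N (leq_addr _ _); have := H2 (N1 + N2)%N (leq_addl _ _).
rewrite /= !sub0r !normrN => /(le_lt_trans (ler_norm _)) b2 /(le_lt_trans (ler_norm _)) b1.
set s := s_ _ in b1 b2.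
have p_le : sqn p <= 2 * sqn (fun x => p x - combo estep s x) + 2 * sqn (combo estep s).
  have := sqnD_le (Lfun2B p2 (cE2 s)) (cE2 s).
  by rewrite (_ : (fun x => _) = p)//; apply/funext => x; ring.
have F_le : sqn (combo hstep s) <= 2 * sqn (fun x => combo hstep s x - P x) + 2 * sqn P.
  have := sqnD_le (Lfun2B (cF2 s) P2) P2.
  by rewrite (_ : (fun x => _) = combo hstep s)//; apply/funext => x; ring.
have : C * sqn p <= 4 * sqn P + e * C.
  by move: p_le F_le b1 b2; rewrite sqn_combo_hstep sqnBC; nra.
rewrite -ler_pdivlMl// => /le_trans; apply.
by rewrite le_eqVlt; apply/orP; left; apply/eqP; field; rewrite gt_eqF.
Qed.

End hartley.

(** * Fourier transform in L^2 *)

Section fourier.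
Context {R : realType}.
Local Notation mu := (@lebesgue_measure R).
Local Notation L2r := (Lfun mu 2%:E).
Local Notation C := (@hartley_cst R).
Implicit Types (s t : seq (R * R)) (p q P Q : R -> R).

Definition evenp P (k : R) : R := (P k + P (- k)) / 2.
Definition oddp P (k : R) : R := (P k - P (- k)) / 2.

Lemma Lfun2_opp P : P \in L2r -> (fun k => P (- k)) \in L2r.
Proof.
move=> /[dup] P2 /Lfun2P[mP iP].
have mN : measurable_fun setT (fun k : R => P (- k)).
  by apply: (@measurableT_comp _ _ _ _ _ _ P).
apply/Lfun2P; split => //; apply/integrableP; split.
  by apply/measurable_EFinP; exact: measurable_funM.
apply: le_lt_trans (ltry (sqn P)); rewrite -sqn_EFin//.
rewrite [leRHS](@ge0_integral_opp R (fun k => P k ^+ 2)); last 2 first.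
- exact: measurable_funX.
- by move=> x; exact: sqr_ge0.
rewrite le_eqVlt; apply/orP; left; apply/eqP; apply: eq_integral => k _ /=.
by rewrite -expr2 ger0_norm// sqr_ge0.
Qed.

Lemma sqn_opp P : P \in L2r -> sqn (fun k => P (- k)) = sqn P.
Proof.
move=> P2; have [] : ((sqn (fun k => P (- k)))%:E = (sqn P)%:E)%E; last by [].
rewrite -!sqn_EFin//; last exact: Lfun2_opp.
rewrite [RHS]ge0_integral_opp//.
- by apply: measurable_funX; exact: measurable_Lfun2.
- by move=> x; exact: sqr_ge0.
Qed.

Lemma Lfun2_evenp P : P \in L2r -> evenp P \in L2r.
Proof.
move=> P2; rewrite (_ : evenp P = fun k => 2^-1 * (P k + P (- k))).
  by apply: Lfun2Z; apply: Lfun2D => //; exact: Lfun2_opp.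
by apply/funext => k; rewrite mulrC.
Qed.

Lemma Lfun2_oddp P : P \in L2r -> oddp P \in L2r.
Proof.
move=> P2; rewrite (_ : oddp P = fun k => 2^-1 * (P k - P (- k))).
  by apply: Lfun2Z; apply: Lfun2B => //; exact: Lfun2_opp.
by apply/funext => k; rewrite mulrC.
Qed.

Lemma sqn_evenp_le P : P \in L2r -> sqn (evenp P) <= sqn P.
Proof.
move=> P2; have N2 := Lfun2_opp P2.
rewrite (_ : evenp P = fun k => 2^-1 * (P k + P (- k))); last first.
  by apply/funext => k; rewrite mulrC.
rewrite sqnZ; last exact: Lfun2D.
by have := sqnD_le P2 N2; rewrite sqn_opp// expr2; lra.
Qed.

Lemma sqn_oddp_le P : P \in L2r -> sqn (oddp P) <= sqn P.
Proof.
move=> P2; have N2 := Lfun2_opp P2; have NN2 := Lfun2Z (-1) N2.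
rewrite (_ : oddp P = fun k => 2^-1 * (P k + -1 * P (- k))); last first.
  by apply/funext => k; rewrite /oddp; ring.
rewrite sqnZ; last exact: Lfun2D.
by have := sqnD_le P2 NN2; rewrite sqnZ// sqn_opp// !expr2; lra.
Qed.

Lemma evenpB P Q k : evenp P k - evenp Q k = evenp (fun k => P k - Q k) k.
Proof. by rewrite /evenp; ring. Qed.

Lemma oddpB P Q k : oddp P k - oddp Q k = oddp (fun k => P k - Q k) k.
Proof. by rewrite /oddp; ring. Qed.

Lemma evenp_combo s k : evenp (combo hstep s) k = combo cstep s k.
Proof.
rewrite /evenp /combo -big_split mulr_suml; apply: eq_bigr => p _ /=.
by rewrite hstepN /hstep; field.
Qed.

Lemma oddp_combo s k : oddp (combo hstep s) k = combo sstep s k.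
Proof.
rewrite /oddp /combo -sumrB mulr_suml; apply: eq_bigr => p _ /=.
by rewrite hstepN /hstep; field.
Qed.

Lemma Rintegral_combo (w : R -> R) (V : R -> R) s :
  (forall a, mu.-integrable setT (EFin \o (fun x => estep a x * w x)) /\
             \int[mu]_x (estep a x * w x) = V a) ->
  mu.-integrable setT (EFin \o (fun x => combo estep s x * w x)) /\
  \int[mu]_x (combo estep s x * w x) = \sum_(p <- s) p.1 * V p.2.
Proof.
move=> H; elim: s => [|p s [i1 i2]].
  rewrite combo_nil big_nil; split.
    rewrite (_ : _ \o _ = cst 0%E); first exact: (integrable0 mu setT).
    by apply/funext => x /=; rewrite mul0r.
  by under eq_Rintegral do rewrite mul0r; rewrite Rintegral_cst// mul0r.
have [h1 h2] := H p.2.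
have E : (fun x => combo estep (p :: s) x * w x) =
    (fun x => p.1 * (estep p.2 x * w x) + combo estep s x * w x).
  by apply/funext => x; rewrite combo_cons; ring.
have h3 : mu.-integrable setT (EFin \o (fun x => p.1 * (estep p.2 x * w x))).
  rewrite (_ : _ \o _ = (fun x => p.1%:E * (estep p.2 x * w x)%:E)%E)//.
  exact: integrableZl.
rewrite E big_cons; split.
  rewrite (_ : _ \o _ = (fun x => (p.1 * (estep p.2 x * w x))%:E + (combo estep s x * w x)%:E)%E)//.
  exact: integrableD.
by rewrite RintegralD// i2 RintegralZl// h2.
Qed.

Lemma integrable_combo_estep s : mu.-integrable setT (EFin \o combo estep s).
Proof.
have [|+ _] := @Rintegral_combo (fun=> 1) (fun a => \int[mu]_x (estep a x * 1)) s.
  move=> a; split => //.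
  rewrite (_ : _ \o _ = EFin \o estep a); first exact: integrable_estep.
  by apply/funext => x /=; rewrite mulr1.
rewrite (_ : _ \o (fun x => _ * 1) = EFin \o combo estep s)//.
by apply/funext => x /=; rewrite mulr1.
Qed.

(** (s + it) e^{ikx} has real part s cos - t sin and imaginary part s sin + t cos. The frequency 0
    is excluded because [hstep] has the wrong value there. *)
Lemma fourierL1_combo s t k : k != 0 ->
  fourierL1 (fun x => combo estep s x +i* combo estep t x) k =
  (evenp (combo hstep s) k - oddp (combo hstep t) k)
  +i* (oddp (combo hstep s) k + evenp (combo hstep t) k).
Proof.
move=> k0.
have hc a := Rintegral_estep_cos a k0; have hs a := Rintegral_estep_sin a k0.
have [sc1 sc2] := Rintegral_combo s hc; have [tc1 tc2] := Rintegral_combo t hc.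
have [ss1 ss2] := Rintegral_combo s hs; have [ts1 ts2] := Rintegral_combo t hs.
rewrite /fourierL1 !evenp_combo !oddp_combo; congr (_ +i* _).
  by rewrite /combo -sc2 -ts2 -RintegralB//; apply: eq_Rintegral => y _.
by rewrite /combo -ss2 -tc2 -RintegralD//; apply: eq_Rintegral => y _.
Qed.

Lemma normL2_sqn (h : R -> R[i]) : L2 h ->
  normL2 h = (Num.sqrt (sqn (fun x => complex.Re (h x)) + sqn (fun x => complex.Im (h x))))%:E.
Proof.
move=> [r2 i2]; have r2' : (fun x => complex.Re (h x)) \in L2r by exact: r2.
have i2' : (fun x => complex.Im (h x)) \in L2r by exact: i2.
rewrite /normL2 unlock /Lnorm.
have E x : (`|(ComplexField.Normc.normc (h x))%:E| `^ 2 =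
    ((complex.Re (h x)) ^+ 2)%:E + ((complex.Im (h x)) ^+ 2)%:E)%E.
  case: (h x) => a b /=; rewrite powR_mulrn// -EFinD; congr EFin.
  by rewrite real_normK ?num_real// sqr_sqrtr// addr_ge0 ?sqr_ge0.
under eq_integral do rewrite E.
rewrite ge0_integralD//=; do ?[by move=> x _; rewrite lee_fin sqr_ge0
  |by apply/measurable_EFinP; apply: measurable_funX; exact: measurable_Lfun2].
rewrite !sqn_EFin// -EFinD poweR_EFin powR12_sqrt//.
by rewrite addr_ge0 ?sqn_ge0.
Qed.

Lemma cvg0_squeeze (u v : nat -> R) : (forall n, 0 <= u n <= v n) ->
  v @ \oo --> 0 -> u @ \oo --> 0.
Proof.
move=> uv v0; apply: (@squeeze_cvgr _ _ _ _ (fun=> 0) v) => //.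
  by apply: nearW => n; exact: uv.
exact: cvg_cst.
Qed.

Lemma cvgL2_sqn (h_ : nat -> R -> R[i]) (h : R -> R[i]) :
  (forall n, L2 (fun x => h_ n x - h x)) ->
  (fun n => sqn (fun x => complex.Re (h_ n x - h x))) @ \oo --> 0 ->
  (fun n => sqn (fun x => complex.Im (h_ n x - h x))) @ \oo --> 0 ->
  cvgL2 h_ h.
Proof.
move=> h2 rc ic; rewrite /cvgL2.
rewrite (_ : (fun n => normL2 _) = fun n => (Num.sqrt (sqn (fun x => complex.Re (h_ n x - h x))
    + sqn (fun x => complex.Im (h_ n x - h x))))%:E); last first.
  by apply/funext => n; exact: (normL2_sqn (h2 n)).
apply: cvg_EFin; first exact: nearW.
have : (fun n => sqn (fun x => complex.Re (h_ n x - h x)) +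
    sqn (fun x => complex.Im (h_ n x - h x))) @ \oo --> 0.
  by rewrite -[X in _ --> X]addr0; exact: cvgD.
move=> H; rewrite -[X in _ --> X]sqrtr0.
apply: (@continuous_cvg _ _ _ _ _ _ (@Num.sqrt R)) => //; exact: sqrt_continuous.
Qed.

(** Measurability of f is part of the conclusion: f is g plus a multiple of the indicator of {0}. *)
Lemma Lfun2_neq0 (f g : R -> R) : g \in L2r -> (forall k, k != 0 -> f k = g k) ->
  f \in L2r /\ sqn f = sqn g.
Proof.
move=> g2 fg.
have fE : f = fun k => g k + (f 0 - g 0) * \1_[set (0:R)] k.
  apply/funext => k; rewrite indicE; have [->|k0] := eqVneq k 0.
    by rewrite mem_set// mulr1; ring.
  by rewrite memNset ?mulr0 ?addr0 ?fg//; exact/eqP.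
have z2 : (\1_[set (0:R)] : R -> R) \in L2r.
  apply: (@Lfun2_le R (ivl 0 1)); [exact: measurable_indic|exact: Lfun2_ivl|].
  move=> x; rewrite indicE /ivl; have [->|x0] := eqVneq x 0.
    by rewrite mem_set// lexx ltr01.
  by rewrite memNset ?normr0//; exact/eqP.
have f2 : f \in L2r by rewrite fE; apply: Lfun2D => //; exact: Lfun2Z.
split => //; rewrite /sqn /dot /Rintegral; congr fine.
apply: ae_eq_integral => //.
- by apply/measurable_EFinP; apply: measurable_funM; exact: measurable_Lfun2.
- by apply/measurable_EFinP; apply: measurable_funM; exact: measurable_Lfun2.
move: (@ae_neq0 R); apply: (@filterS _ _ (ae_filter_ringOfSetsType mu)) => k k0 _ /=.
by rewrite fg.
Qed.

Lemma is_fourierL2_pair p q P Q : hartley_pair p P -> hartley_pair q Q ->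
  is_fourierL2 (fun x => p x +i* q x)
    (fun k => (evenp P k - oddp Q k) +i* (oddp P k + evenp Q k)).
Proof.
move=> [p2 P2 [s_ [s1 s2]]] [q2 Q2 [t_ [t1 t2]]].
have cE2 := @Lfun2_combo_estep R; have cF2 := @Lfun2_combo_hstep R.
split.
- by split.
- split; [rewrite (_ : _ \o _ = (fun k => evenp P k - oddp Q k))//|
    rewrite (_ : _ \o _ = (fun k => oddp P k + evenp Q k))//].
    by apply: Lfun2B; [exact: Lfun2_evenp|exact: Lfun2_oddp].
  by apply: Lfun2D; [exact: Lfun2_oddp|exact: Lfun2_evenp].
exists (fun n x => combo estep (s_ n) x +i* combo estep (t_ n) x); split.
- move=> n; split; split.
  + by apply/Lfun1_integrable; exact: integrable_combo_estep.
  + by apply/Lfun1_integrable; exact: integrable_combo_estep.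
  + exact: (cE2 (s_ n)).
  + exact: (cE2 (t_ n)).
- apply: cvgL2_sqn => [n| |].
  + by split; [exact: (Lfun2B (cE2 (s_ n)) p2)|exact: (Lfun2B (cE2 (t_ n)) q2)].
  + exact: s1.
  + exact: t1.
pose S n k := combo hstep (s_ n) k - P k.
pose T n k := combo hstep (t_ n) k - Q k.
have S2 n : S n \in L2r by exact: Lfun2B.
have T2 n : T n \in L2r by exact: Lfun2B.
pose r n k := evenp (S n) k - oddp (T n) k.
pose i n k := oddp (S n) k + evenp (T n) k.
have r2 n : r n \in L2r by apply: Lfun2B; [exact: Lfun2_evenp|exact: Lfun2_oddp].
have i2 n : i n \in L2r by apply: Lfun2D; [exact: Lfun2_oddp|exact: Lfun2_evenp].
(* The error agrees with r + i i_n, where r and i_n denote [r n] and [i n], only for k != 0;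
   [Lfun2_neq0] absorbs the exceptional point. *)
pose D n k := fourierL1 (fun x => combo estep (s_ n) x +i* combo estep (t_ n) x) k -
   ((evenp P k - oddp Q k) +i* (oddp P k + evenp Q k)).
have rE n k : k != 0 -> complex.Re (D n k) = r n k.
  by move=> k0; rewrite /D fourierL1_combo//= /r -!evenpB -!oddpB; ring.
have iE n k : k != 0 -> complex.Im (D n k) = i n k.
  by move=> k0; rewrite /D fourierL1_combo//= /i -!evenpB -!oddpB; ring.
have rD n := Lfun2_neq0 (r2 n) (rE n); have iD n := Lfun2_neq0 (i2 n) (iE n).
have ST : (fun n => 2 * sqn (S n) + 2 * sqn (T n)) @ \oo --> 0.
  rewrite (_ : 0 = 2 * 0 + 2 * 0 :> R); last by ring.
  by apply: cvgD; apply: cvgMr.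
apply: cvgL2_sqn => [n| |].
- by split; [exact: (rD n).1|exact: (iD n).1].
- rewrite [X in X @ _](_ : _ = fun n => sqn (r n)); last first.
    by apply/funext => n; exact: (rD n).2.
  apply: cvg0_squeeze ST => n; rewrite sqn_ge0 /=.
  rewrite (_ : r n = fun k => evenp (S n) k + -1 * oddp (T n) k); last first.
    by apply/funext => k; rewrite /r; ring.
  apply: le_trans (sqnD_le _ _) _; [exact: Lfun2_evenp|by apply: Lfun2Z; exact: Lfun2_oddp|].
  rewrite sqnZ; last exact: Lfun2_oddp.
  by have := sqn_evenp_le (S2 n); have := sqn_oddp_le (T2 n); rewrite expr2; lra.
rewrite [X in X @ _](_ : _ = fun n => sqn (i n)); last first.
  by apply/funext => n; exact: (iD n).2.
apply: cvg0_squeeze ST => n; rewrite sqn_ge0 /=.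
apply: le_trans (sqnD_le _ _) _; [exact: Lfun2_oddp|exact: Lfun2_evenp|].
by have := sqn_oddp_le (S2 n); have := sqn_evenp_le (T2 n); lra.
Qed.

End fourier.

(** * Fourier pairs of complex-valued functions *)

Section fourier_pair.
Context {R : realType}.
Local Notation mu := (@lebesgue_measure R).
Local Notation L2r := (Lfun mu 2%:E).
Local Notation C := (@hartley_cst R).
Local Notation Re := (@complex.Re R).
Local Notation Im := (@complex.Im R).
Implicit Types (h H : R -> R[i]) (p q P Q : R -> R).

Lemma hartley_pairD p q P Q : hartley_pair p P -> hartley_pair q Q ->
  hartley_pair (fun x => p x + q x) (fun k => P k + Q k).
Proof.
move=> [p2 P2 [s_ [s1 s2]]] [q2 Q2 [t_ [t1 t2]]].
have cE2 := @Lfun2_combo_estep R; have cF2 := @Lfun2_combo_hstep R.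
split; [exact: Lfun2D|exact: Lfun2D|exists (fun n => s_ n ++ t_ n)].
have key (E : R -> R -> R) f g : (forall s, combo E s \in L2r) -> f \in L2r -> g \in L2r ->
  (fun n => sqn (fun x => combo E (s_ n) x - f x)) @ \oo --> 0 ->
  (fun n => sqn (fun x => combo E (t_ n) x - g x)) @ \oo --> 0 ->
  (fun n => sqn (fun x => combo E (s_ n ++ t_ n) x - (f x + g x))) @ \oo --> 0.
  move=> E2 f2 g2 c1 c2.
  apply: (@cvg0_squeeze _ _ (fun n => 2 * sqn (fun x => combo E (s_ n) x - f x) +
                               2 * sqn (fun x => combo E (t_ n) x - g x))).
    move=> n; rewrite sqn_ge0 /=.
    rewrite (_ : (fun x => combo E (s_ n ++ t_ n) x - _) =
      fun x => (combo E (s_ n) x - f x) + (combo E (t_ n) x - g x)).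
      by apply: sqnD_le; exact: Lfun2B.
    by apply/funext => x; rewrite combo_cat; ring.
  rewrite (_ : 0 = 2 * 0 + 2 * 0 :> R); last by ring.
  by apply: cvgD; apply: cvgMr.
by split; exact: key.
Qed.

Definition hatRe H (k : R) : R := evenp (fun k => Re (H k)) k + oddp (fun k => Im (H k)) k.
Definition hatIm H (k : R) : R := evenp (fun k => Im (H k)) k - oddp (fun k => Re (H k)) k.

(* [hatRe H] and [hatIm H] are the Hartley transforms of the real and
   imaginary parts of the function whose Fourier transform is [H]. *)
Definition fourier_pair h H :=
  hartley_pair (fun x => Re (h x)) (hatRe H) /\
  hartley_pair (fun x => Im (h x)) (hatIm H).

Lemma hatReE H k : evenp (hatRe H) k - oddp (hatIm H) k = Re (H k).
Proof. by rewrite /hatRe /hatIm /evenp /oddp !opprK; field. Qed.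

Lemma hatImE H k : oddp (hatRe H) k + evenp (hatIm H) k = Im (H k).
Proof. by rewrite /hatRe /hatIm /evenp /oddp !opprK; field. Qed.

Lemma fourier_pairP h H : fourier_pair h H -> is_fourierL2 h H.
Proof.
move=> [/is_fourierL2_pair/[apply]].
rewrite (_ : (fun x => Re (h x) +i* Im (h x)) = h); last first.
  by apply/funext => x; case: (h x).
rewrite (_ : (fun k => _ +i* _) = H)//.
by apply/funext => k; rewrite hatReE hatImE; case: (H k).
Qed.

Lemma fourier_pairD h g H G : fourier_pair h H -> fourier_pair g G ->
  fourier_pair (fun x => h x + g x) (fun k => H k + G k).
Proof.
move=> [h1 h2] [g1 g2]; split.
  have := hartley_pairD h1 g1; congr hartley_pair; apply/funext => x.
    by rewrite raddfD.
  by rewrite /hatRe /evenp /oddp !raddfD /=; field.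
have := hartley_pairD h2 g2; congr hartley_pair; apply/funext => x.
  by rewrite raddfD.
by rewrite /hatIm /evenp /oddp !raddfD /=; field.
Qed.

Lemma fourier_pair_ex h : L2 h -> exists H, fourier_pair h H.
Proof.
move=> [h1 h2]; have [P hP] := hartley_pair_ex h1; have [Q hQ] := hartley_pair_ex h2.
exists (fun k => (evenp P k - oddp Q k) +i* (oddp P k + evenp Q k)); split.
  move: hP; congr hartley_pair; apply/funext => k.
  by rewrite /hatRe /evenp /oddp /= !opprK; field.
move: hQ; congr hartley_pair; apply/funext => k.
by rewrite /hatIm /evenp /oddp /= !opprK; field.
Qed.

Lemma Lfun2_hat H : L2 H -> hatRe H \in L2r /\ hatIm H \in L2r.
Proof.
move=> [H1 H2]; split.
  by apply: Lfun2D; [exact: Lfun2_evenp|exact: Lfun2_oddp].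
by apply: Lfun2B; [exact: Lfun2_evenp|exact: Lfun2_oddp].
Qed.

Lemma fourier_pair_onto H : L2 H -> exists h, fourier_pair h H.
Proof.
move=> /Lfun2_hat[H1 H2].
have [p hp] := hartley_pair_onto H1; have [q hq] := hartley_pair_onto H2.
by exists (fun x => p x +i* q x).
Qed.

(** Carries smallness from the transform back to the function. The squared norms of [hatRe H] and
    [hatIm H] are each at most twice the total for H, and [hartley_pair_sqn_le] multiplies their sum
    by 4 / C. *)
Lemma fourier_pair_sqn_le h H : L2 H -> fourier_pair h H ->
  sqn (fun x => Re (h x)) + sqn (fun x => Im (h x)) <=
  16 / C * (sqn (fun k => Re (H k)) + sqn (fun k => Im (H k))).
Proof.
move=> [H1 H2] [/hartley_pair_sqn_le h1 /hartley_pair_sqn_le h2].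
have {}H1 : (fun k => Re (H k)) \in L2r by [].
have {}H2 : (fun k => Im (H k)) \in L2r by [].
have C0 := @hartley_cst_gt0 R.
set a := sqn (fun k => Re (H k)); set b := sqn (fun k => Im (H k)).
have hR : sqn (hatRe H) <= 2 * a + 2 * b.
  apply: le_trans (sqnD_le (Lfun2_evenp H1) (Lfun2_oddp H2)) _.
  by have := sqn_evenp_le H1; have := sqn_oddp_le H2; rewrite -/a -/b; lra.
have hI : sqn (hatIm H) <= 2 * a + 2 * b.
  rewrite (_ : hatIm H = fun k => evenp (fun k => Im (H k)) k +
    -1 * oddp (fun k => Re (H k)) k); last first.
    by apply/funext => k; rewrite mulN1r.
  apply: le_trans (sqnD_le (Lfun2_evenp H2) (Lfun2Z _ (Lfun2_oddp H1))) _.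
  rewrite sqnZ; last exact: Lfun2_oddp.
  by have := sqn_evenp_le H2; have := sqn_oddp_le H1; rewrite -/a -/b expr2; lra.
have C4 : 0 <= 4 / C by rewrite divr_ge0// ltW.
apply: le_trans (lerD h1 h2) _.
rewrite -mulrDr (_ : 16 / C * _ = 4 / C * (4 * (a + b))); last by ring.
by rewrite ler_wpM2l//; lra.
Qed.

(** The transform of a real function has even real part and odd imaginary part, so [hatIm] vanishes.
    The empty list provides the zero pair. *)
Lemma fourier_pair_combo (s : seq (R * R)) :
  fourier_pair (cfun (combo estep s)) (fun k => combo cstep s k +i* combo sstep s k).
Proof.
have N k : combo cstep s (- k) = combo cstep s k /\ combo sstep s (- k) = - combo sstep s k.
  by rewrite -!evenp_combo -!oddp_combo /evenp /oddp opprK; split; field.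
split.
  rewrite (_ : hatRe _ = combo hstep s); first exact: hartley_pair_combo.
  apply/funext => k; rewrite /hatRe /evenp /oddp /= (N k).1 (N k).2.
  have := evenp_combo s k; have := oddp_combo s k.
  by rewrite /evenp /oddp => <- <-; field.
have := hartley_pair_combo (R := R) [::]; rewrite !combo_nil.
rewrite (_ : hatIm _ = fun=> 0)//.
by apply/funext => k; rewrite /hatIm /evenp /oddp /= (N k).1 (N k).2; field.
Qed.

End fourier_pair.

(** * Duhamel formula *)

Section complex_parts.
Context {R : realType}.
Implicit Types z w : R[i].

Lemma cReD z w : complex.Re (z + w) = complex.Re z + complex.Re w.
Proof. by case: z; case: w. Qed.

Lemma cImD z w : complex.Im (z + w) = complex.Im z + complex.Im w.
Proof. by case: z; case: w. Qed.

Lemma cReB z w : complex.Re (z - w) = complex.Re z - complex.Re w.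
Proof. by case: z; case: w. Qed.

Lemma cImB z w : complex.Im (z - w) = complex.Im z - complex.Im w.
Proof. by case: z; case: w. Qed.

Lemma cReM z w : complex.Re (z * w) =
  complex.Re z * complex.Re w - complex.Im z * complex.Im w.
Proof. by case: z; case: w. Qed.

Lemma cImM z w : complex.Im (z * w) =
  complex.Re z * complex.Im w + complex.Im z * complex.Re w.
Proof. by case: z; case: w. Qed.

End complex_parts.

(** * The ordinary differential equation at a fixed frequency *)

Section multiplier.
Context {R : realType}.
Local Notation mu := (@lebesgue_measure R).
Local Notation L2r := (Lfun mu 2%:E).
Local Notation Re := (@complex.Re R).
Local Notation Im := (@complex.Im R).
Variables (lam om : R -> R).
Hypothesis lam_le0 : forall k, lam k <= 0.
Implicit Types (F G : R -> R[i]) (t k : R).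

Definition expRe k t : R := expR (t * lam k) * cos (t * om k).
Definition expIm k t : R := expR (t * lam k) * sin (t * om k).

(* [e^{t (lam + i om)} G] *)
Definition propagate G k t : R[i] :=
  (expRe k t * Re (G k) - expIm k t * Im (G k))
  +i* (expIm k t * Re (G k) + expRe k t * Im (G k)).

(* [- F / (lam + i om)] *)
Definition stationary F k : R[i] :=
  (- (Re (F k) * lam k + Im (F k) * om k) / (lam k ^+ 2 + om k ^+ 2))
  +i* (- (Im (F k) * lam k - Re (F k) * om k) / (lam k ^+ 2 + om k ^+ 2)).

(** The stationary solution minus its own free evolution, that is F (e^{t phi} - 1) / phi with phi =
    lam + i om. Where phi = 0, division by zero makes it 0 instead of t F. *)
Definition duhamel F k t : R[i] := stationary F k - propagate (stationary F) k t.

Definition solution_hat G F k t : R[i] := propagate G k t + duhamel F k t.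

Arguments propagate : simpl never.
Arguments stationary : simpl never.
Arguments duhamel : simpl never.
Arguments solution_hat : simpl never.

Lemma one_sub_cos_norm_le (x : R) : 1 - cos x <= `|x|.
Proof.
rewrite one_sub_cos.
have h1 := norm_sin_le (x / 2); have h2 := sin_max (x / 2).
rewrite normrM (ger0_norm (_ : 0 <= 2^-1)) ?invr_ge0// in h1.
move: h1 h2; rewrite -real_normK ?num_real//.
by have := normr_ge0 (sin (x / 2)); set a := `|sin _|; nra.
Qed.

Lemma expR_le1_lam k t : 0 <= t -> 0 < expR (t * lam k) <= 1.
Proof.
move=> t0; rewrite expR_gt0 -expR0 ler_expR /=.
by rewrite mulr_ge0_le0.
Qed.

Lemma expRe_max k t : 0 <= t -> `|expRe k t| <= 1.
Proof.
move=> t0; have /andP[e0 e1] := expR_le1_lam k t0.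
by rewrite normrM gtr0_norm// mulr_ile1// ?cos_max// ltW.
Qed.

Lemma expIm_max k t : 0 <= t -> `|expIm k t| <= 1.
Proof.
move=> t0; have /andP[e0 e1] := expR_le1_lam k t0.
by rewrite normrM gtr0_norm// mulr_ile1// ?sin_max// ltW.
Qed.

Lemma one_sub_expRe_le k t : 0 <= t -> `|1 - expRe k t| <= t * (`|lam k| + `|om k|).
Proof.
move=> t0; have /andP[e0 e1] := expR_le1_lam k t0.
have -> : 1 - expRe k t = (1 - expR (t * lam k)) + expR (t * lam k) * (1 - cos (t * om k)).
  by rewrite /expRe; ring.
have c1 := one_sub_cos_norm_le (t * om k); have c0 := cos_le1 (t * om k).
rewrite normrM (ger0_norm t0) in c1.
have h1 := expR_ge1Dx (t * lam k).
rewrite (ler0_norm (lam_le0 k)) ger0_norm; last first.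
  by rewrite addr_ge0 ?mulr_ge0 ?subr_ge0// ltW.
rewrite [leRHS]mulrDr lerD//; first lra.
by apply: le_trans c1; rewrite ler_piMl// subr_ge0.
Qed.

Lemma expIm_le k t : 0 <= t -> `|expIm k t| <= t * (`|lam k| + `|om k|).
Proof.
move=> t0; have /andP[e0 e1] := expR_le1_lam k t0.
rewrite normrM gtr0_norm//; apply: (@le_trans _ _ `|sin (t * om k)|).
  by rewrite ler_piMl.
apply: le_trans (norm_sin_le _) _; rewrite normrM ger0_norm// ler_wpM2l//.
by rewrite lerDr.
Qed.

Lemma norm_propagate_le G k t : 0 <= t ->
  `|Re (propagate G k t)| <= `|Re (G k)| + `|Im (G k)| /\
  `|Im (propagate G k t)| <= `|Re (G k)| + `|Im (G k)|.
Proof.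
move=> t0; have h1 := expRe_max k t0; have h2 := expIm_max k t0.
have H (a b x : R) : `|a| <= 1 -> `|a * x| <= `|x|.
  by move=> a1; rewrite normrM ler_piMl.
split; rewrite /propagate /=.
  by apply: le_trans (ler_normB _ _) _; rewrite lerD// H.
by apply: le_trans (ler_normD _ _) _; rewrite lerD// H.
Qed.

(** Free of division, so that it holds also where lam and om vanish. The factor 2 comes from (|lam|
    + |om|)^2 <= 2 (lam^2 + om^2). *)
Lemma norm_stationary_le F k :
  `|Re (stationary F k)| * (`|lam k| + `|om k|) <= 2 * (`|Re (F k)| + `|Im (F k)|) /\
  `|Im (stationary F k)| * (`|lam k| + `|om k|) <= 2 * (`|Re (F k)| + `|Im (F k)|).
Proof.
set r := `|lam k| + `|om k|; set f := `|Re (F k)| + `|Im (F k)|.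
have r0 : 0 <= r by rewrite addr_ge0.
have f0 : 0 <= f by rewrite addr_ge0.
have [rz|rn] := eqVneq r 0.
  by rewrite rz !mulr0 !mulr_ge0.
have rp : 0 < r by rewrite lt_neqAle eq_sym rn.
set n2 := lam k ^+ 2 + om k ^+ 2.
have n2E : n2 = `|lam k| ^+ 2 + `|om k| ^+ 2 by rewrite !real_normK ?num_real.
have rn2 : r ^+ 2 <= 2 * n2.
  by rewrite n2E /r; have := sqr_ge0 (`|lam k| - `|om k|); nra.
have n20 : 0 < n2.
  have : 0 < r ^+ 2 by rewrite exprn_gt0.
  lra.
have key (a b : R) : `|a| <= f * r -> `|- a / n2| * r <= 2 * f.
  move=> ar; rewrite normrM normrN (gtr0_norm (_ : 0 < n2^-1)) ?invr_gt0//.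
  rewrite mulrAC ler_pdivrMr//; apply: le_trans (ler_wpM2r r0 ar) _.
  by rewrite -mulrA -expr2 (mulrC 2) -mulrA ler_wpM2l.
have := normr_ge0 (lam k); have := normr_ge0 (om k).
have := normr_ge0 (Re (F k)); have := normr_ge0 (Im (F k)) => *.
split; apply: key => //.
  apply: le_trans (ler_normD _ _) _; rewrite !normrM /f /r; nra.
apply: le_trans (ler_normB _ _) _; rewrite !normrM /f /r; nra.
Qed.

Lemma Re_duhamel F k t : Re (duhamel F k t) =
  (1 - expRe k t) * Re (stationary F k) + expIm k t * Im (stationary F k).
Proof. by rewrite /duhamel cReB /propagate /=; ring. Qed.

Lemma Im_duhamel F k t : Im (duhamel F k t) =
  (1 - expRe k t) * Im (stationary F k) - expIm k t * Re (stationary F k).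
Proof. by rewrite /duhamel cImB /propagate /=; ring. Qed.

(** Two regimes. The first pair comes from |e^{t phi} - 1| = O(t |phi|), which cancels the division
    by phi and serves low frequencies; the second comes from |e^{t phi}| <= 1 and gives decay at
    high frequencies. *)
Lemma norm_duhamel_le F k t : 0 <= t ->
  let f : R := `|Re (F k)| + `|Im (F k)| in let r : R := `|lam k| + `|om k| in
  (`|Re (duhamel F k t)| <= 4 * t * f /\ `|Im (duhamel F k t)| <= 4 * t * f) /\
  (`|Re (duhamel F k t)| * r <= 6 * f /\ `|Im (duhamel F k t)| * r <= 6 * f).
Proof.
move=> t0 f r; rewrite Re_duhamel Im_duhamel.
have [] := norm_stationary_le F k; rewrite -/f -/r.
have := one_sub_expRe_le k t0; have := expIm_le k t0; rewrite -/r.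
have x2 : `|1 - expRe k t| <= 2.
  by apply: le_trans (ler_normB _ _) _; rewrite normr1; have := expRe_max k t0; lra.
have := expIm_max k t0; move: x2.
set x := 1 - _; set y := expIm _ _;
set b1 := Re (stationary F k); set b2 := Im (stationary F k).
have r0 : 0 <= r by rewrite addr_ge0.
move=> x2 y1 yr xr h1 h2.
have H (u v c d : R) : `|u * c + v * d| <= `|u| * `|c| + `|v| * `|d|.
  by apply: le_trans (ler_normD _ _) _; rewrite !normrM.
have H' (u v c d : R) : `|u * c - v * d| <= `|u| * `|c| + `|v| * `|d|.
  by apply: le_trans (ler_normB _ _) _; rewrite !normrM.
have X0 := normr_ge0 x; have Y0 := normr_ge0 y.
have B1 := normr_ge0 b1; have B2 := normr_ge0 b2.
have K1 (c d : R) : 0 <= c -> 0 <= d -> c * r <= 2 * f -> d * r <= 2 * f ->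
    `|x| * c + `|y| * d <= 4 * t * f.
  move=> c0 d0 cr dr; apply: (@le_trans _ _ (t * r * c + t * r * d)).
    by rewrite lerD// ler_wpM2r.
  rewrite -!mulrA (mulrC r c) (mulrC r d) -mulrDr mulrCA ler_wpM2l//; lra.
have K2 (c d : R) : 0 <= c -> 0 <= d -> c * r <= 2 * f -> d * r <= 2 * f ->
    (`|x| * c + `|y| * d) * r <= 6 * f.
  move=> c0 d0 cr dr; rewrite mulrDl -!mulrA.
  have : `|x| * (c * r) <= 2 * (c * r) by rewrite ler_wpM2r// mulr_ge0.
  have : `|y| * (d * r) <= 1 * (d * r) by rewrite ler_wpM2r// mulr_ge0.
  lra.
split; split.
- by apply: le_trans (H _ _ _ _) _; exact: K1.
- by apply: le_trans (H' _ _ _ _) _; exact: K1.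
- by apply: le_trans (ler_wpM2r r0 (H _ _ _ _)) _; exact: K2.
- by apply: le_trans (ler_wpM2r r0 (H' _ _ _ _)) _; exact: K2.
Qed.

Lemma is_derive_exp (l w c1 c2 c3 t : R) :
  is_derive t (1 : R) (fun t => expR (t * l) * cos (t * w) * c1 +
                              expR (t * l) * sin (t * w) * c2 + c3)
   ((l * (expR (t * l) * cos (t * w)) - w * (expR (t * l) * sin (t * w))) * c1 +
    (l * (expR (t * l) * sin (t * w)) + w * (expR (t * l) * cos (t * w))) * c2).
Proof.
have L (a : R) : is_derive t (1:R) (fun t => t * a) a.
  by apply: is_derive_eq; rewrite ?scaler0 ?add0r /GRing.scale/= ?mulr1 ?mulr0 ?addr0 ?add0r.
have e : is_derive t (1:R) (fun t => expR (t * l)) (expR (t * l) * l).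
  exact: (@is_derive1_comp _ expR (fun t => t * l)).
have c : is_derive t (1:R) (fun t => cos (t * w)) (- sin (t * w) * w).
  exact: (@is_derive1_comp _ cos (fun t => t * w)).
have s : is_derive t (1:R) (fun t => sin (t * w)) (cos (t * w) * w).
  exact: (@is_derive1_comp _ sin (fun t => t * w)).
apply: is_derive_eq.
by rewrite /GRing.scale/=; ring.
Qed.

(** The form e^{t phi} (G - b) + b, split into parts so that [is_derive_exp] applies. *)
Lemma solution_hatE G F k : let b := stationary F k in
  (Re \o solution_hat G F k = fun t => expRe k t * (Re (G k) - Re b) +
      expIm k t * - (Im (G k) - Im b) + Re b) /\
  (Im \o solution_hat G F k = fun t => expRe k t * (Im (G k) - Im b) +
      expIm k t * (Re (G k) - Re b) + Im b).
Proof.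
split; apply/funext => t; rewrite /= /solution_hat ?cReD ?cImD ?Re_duhamel ?Im_duhamel.
  by rewrite /propagate /=; ring.
by rewrite /propagate /=; ring.
Qed.

Lemma solution_hat_ode G F k t : lam k != 0 \/ om k != 0 ->
  let rhs := (lam k +i* om k) * solution_hat G F k t + F k in
  is_derive t (1 : R) (Re \o solution_hat G F k) (Re rhs) /\
  is_derive t (1 : R) (Im \o solution_hat G F k) (Im rhs).
Proof.
move=> lo; have [E1 E2] := solution_hatE G F k.
have n0 : lam k ^+ 2 + om k ^+ 2 != 0.
  by rewrite paddr_eq0 ?sqr_ge0// !sqrf_eq0 negb_and; apply/orP.
have R1 : Re (solution_hat G F k t) = (Re \o solution_hat G F k) t by [].
have R2 : Im (solution_hat G F k t) = (Im \o solution_hat G F k) t by [].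
split.
  rewrite /= cReD cReM R1 R2 E1 E2 /=.
  apply: is_derive_eq (is_derive_exp _ _ _ _ _ _) _.
  by rewrite -/(expRe k t) -/(expIm k t) /stationary /=; field.
rewrite /= cImD cImM R1 R2 E1 E2 /=.
apply: is_derive_eq (is_derive_exp _ _ _ _ _ _) _.
by rewrite -/(expRe k t) -/(expIm k t) /stationary /=; field.
Qed.

Lemma propagate0 G k : propagate G k 0 = G k.
Proof.
apply/eqP; rewrite eq_complex /propagate /= /expRe /expIm !mul0r expR0 cos0 sin0.
by apply/andP; split; apply/eqP; ring.
Qed.

Lemma duhamel0 F k : duhamel F k 0 = 0.
Proof. by rewrite /duhamel propagate0 subrr. Qed.

Lemma duhamel_source0 k t : duhamel (fun=> 0) k t = 0.
Proof.
have z : stationary (fun=> 0) k = 0.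
  by apply/eqP; rewrite eq_complex /stationary /= !mul0r addr0 subr0 oppr0 !mul0r eqxx.
by apply/eqP; rewrite eq_complex Re_duhamel Im_duhamel z /= !mulr0 subrr addr0 eqxx.
Qed.

Lemma solution_hat0 G F k : solution_hat G F k 0 = G k.
Proof. by rewrite /solution_hat propagate0 duhamel0 addr0. Qed.

End multiplier.

(** * Measurability and L^2 bounds; return to the space variable *)

Section multiplier_solution.
Context {R : realType}.
Local Notation mu := (@lebesgue_measure R).
Local Notation L2r := (Lfun mu 2%:E).
Local Notation Re := (@complex.Re R).
Local Notation Im := (@complex.Im R).
Variables (lam om : R -> R).
Hypotheses (mlam : measurable_fun setT lam) (mom : measurable_fun setT om).
Hypothesis lam_le0 : forall k, lam k <= 0.
Implicit Types (F G : R -> R[i]) (t k : R).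
Local Notation expRe := (expRe lam om).
Local Notation expIm := (expIm lam om).
Local Notation propagate := (propagate lam om).
Local Notation stationary := (stationary lam om).
Local Notation duhamel := (duhamel lam om).

Section measurability.
Context d (X : measurableType d) (a b : X -> R).
Hypotheses (ma : measurable_fun setT a) (mb : measurable_fun setT b).

Let mlama : measurable_fun setT (fun x => b x * lam (a x)).
Proof. by apply: measurable_funM => //; exact: (measurableT_comp mlam ma). Qed.

Let moma : measurable_fun setT (fun x => b x * om (a x)).
Proof. by apply: measurable_funM => //; exact: (measurableT_comp mom ma). Qed.

Lemma measurable_expRe : measurable_fun setT (fun x => expRe (a x) (b x)).
Proof.
apply: measurable_funM.
  by apply: (@measurableT_comp _ _ _ _ _ _ expR) mlama; exact: measurable_expR.
apply: (@measurableT_comp _ _ _ _ _ _ cos) moma.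
exact: continuous_measurable_fun (@continuous_cos R).
Qed.

Lemma measurable_expIm : measurable_fun setT (fun x => expIm (a x) (b x)).
Proof.
apply: measurable_funM.
  by apply: (@measurableT_comp _ _ _ _ _ _ expR) mlama; exact: measurable_expR.
apply: (@measurableT_comp _ _ _ _ _ _ sin) moma.
exact: continuous_measurable_fun (@continuous_sin R).
Qed.

End measurability.

Lemma measurable_stationary F :
  measurable_fun setT (fun k => Re (F k)) -> measurable_fun setT (fun k => Im (F k)) ->
  measurable_fun setT (fun k => Re (stationary F k)) /\
  measurable_fun setT (fun k => Im (stationary F k)).
Proof.
move=> m1 m2.
have mn : measurable_fun setT (fun k => (lam k ^+ 2 + om k ^+ 2)^-1).
  by apply: measurable_funV; apply: measurable_funD; exact: measurable_funX.
split; rewrite /stationary /=; apply: measurable_funM => //;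
  apply: measurableT_comp => //.
  by apply: measurable_funD; exact: measurable_funM.
by apply: measurable_funB; exact: measurable_funM.
Qed.

Lemma measurable_propagate d (X : measurableType d) (a b : X -> R) F :
  measurable_fun setT a -> measurable_fun setT b ->
  measurable_fun setT (fun k => Re (F k)) -> measurable_fun setT (fun k => Im (F k)) ->
  measurable_fun setT (fun x => Re (propagate F (a x) (b x))) /\
  measurable_fun setT (fun x => Im (propagate F (a x) (b x))).
Proof.
move=> ma mb m1 m2.
have r1 : measurable_fun setT (fun x => Re (F (a x))) by exact: (measurableT_comp m1 ma).
have r2 : measurable_fun setT (fun x => Im (F (a x))) by exact: (measurableT_comp m2 ma).
have e1 := measurable_expRe ma mb; have e2 := measurable_expIm ma mb.
split; rewrite /propagate /=.
  by apply: measurable_funB; exact: measurable_funM.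
by apply: measurable_funD; exact: measurable_funM.
Qed.

Lemma measurable_duhamel d (X : measurableType d) (a b : X -> R) F :
  measurable_fun setT a -> measurable_fun setT b ->
  measurable_fun setT (fun k => Re (F k)) -> measurable_fun setT (fun k => Im (F k)) ->
  measurable_fun setT (fun x => Re (duhamel F (a x) (b x))) /\
  measurable_fun setT (fun x => Im (duhamel F (a x) (b x))).
Proof.
move=> ma mb m1 m2; have [s1 s2] := measurable_stationary m1 m2.
have [p1 p2] := measurable_propagate ma mb s1 s2.
split.
  rewrite [X in measurable_fun _ X](_ : _ = fun x => Re (stationary F (a x)) -
    Re (propagate (stationary F) (a x) (b x))).
    by apply: measurable_funB => //; exact: (measurableT_comp s1 ma).
  by apply/funext => x; rewrite /duhamel cReB.
rewrite [X in measurable_fun _ X](_ : _ = fun x => Im (stationary F (a x)) -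
  Im (propagate (stationary F) (a x) (b x))).
  by apply: measurable_funB => //; exact: (measurableT_comp s2 ma).
by apply/funext => x; rewrite /duhamel cImB.
Qed.

Lemma L2_bounded (c : R) F H : L2 F ->
  measurable_fun setT (fun k => Re (H k)) -> measurable_fun setT (fun k => Im (H k)) ->
  (forall k, `|Re (H k)| <= c * (`|Re (F k)| + `|Im (F k)|) /\
             `|Im (H k)| <= c * (`|Re (F k)| + `|Im (F k)|)) -> L2 H.
Proof.
move=> [F1 F2] m1 m2 HF.
have nL (f : R -> R) : f \in L2r -> (fun k => `|f k|) \in L2r.
  move=> f2; apply: (Lfun2_le _ f2); last by move=> k; rewrite normr_id.
  by apply: measurableT_comp => //; exact: measurable_Lfun2 f2.
have g2 : (fun k => c * (`|Re (F k)| + `|Im (F k)|)) \in L2r.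
  by apply: Lfun2Z; apply: Lfun2D; [exact: (nL _ F1)|exact: (nL _ F2)].
split; apply: (Lfun2_le _ g2) => // k /=.
  by apply: le_trans (HF k).1 (ler_norm _).
by apply: le_trans (HF k).2 (ler_norm _).
Qed.

Lemma measurable_L2 F : L2 F ->
  measurable_fun setT (fun k => Re (F k)) /\ measurable_fun setT (fun k => Im (F k)).
Proof. by move=> [/measurable_Lfun2 h1 /measurable_Lfun2 h2]. Qed.

Lemma L2_propagate F t : L2 F -> 0 <= t -> L2 (fun k => propagate F k t).
Proof.
move=> F2 t0; have [m1 m2] := measurable_L2 F2.
have [p1 p2] := measurable_propagate (@measurable_id _ _ setT) (@measurable_cst _ _ _ _ setT t) m1 m2.
apply: (@L2_bounded 1 F) => // k; rewrite mul1r.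
exact: norm_propagate_le.
Qed.

Lemma L2_duhamel F t : L2 F -> 0 <= t -> L2 (fun k => duhamel F k t).
Proof.
move=> F2 t0; have [m1 m2] := measurable_L2 F2.
have [p1 p2] := measurable_duhamel (@measurable_id _ _ setT) (@measurable_cst _ _ _ _ setT t) m1 m2.
apply: (@L2_bounded (4 * t) F) => // k.
by have [] := norm_duhamel_le om lam_le0 F k t0.
Qed.

(** The preimage chosen at each time is some L^2 representative; at t = 0 it is overridden by g
    itself, so that the initial value is literal. Negative times are irrelevant. *)
Lemma propagator_ex (g : R -> R[i]) G : fourier_pair g G -> L2 G ->
  exists U : R -> R -> R[i], U 0 = g /\
    forall t, 0 <= t -> fourier_pair (U t) (fun k => propagate G k t).
Proof.
move=> gG G2.
have /choice[U hU] : forall t, exists u, 0 <= t -> fourier_pair u (fun k => propagate G k t).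
  move=> t; have [t0|nt] := leP 0 t; last by exists (fun=> 0).
  by have [u hu] := fourier_pair_onto (L2_propagate G2 t0); exists u.
exists (fun t => if t == 0 then g else U t); rewrite eqxx; split=> // t t0.
have [->|_] := eqVneq t 0; last exact: hU.
rewrite (_ : (fun k => _) = G)//; apply/funext => k.
by rewrite propagate0.
Qed.

Lemma duhamel_ex F : L2 F ->
  exists W : R -> R -> R[i], W 0 = (fun=> 0) /\
    forall t, 0 <= t -> fourier_pair (W t) (fun k => duhamel F k t).
Proof.
move=> F2.
have /choice[U hU] : forall t, exists u, 0 <= t -> fourier_pair u (fun k => duhamel F k t).
  move=> t; have [t0|nt] := leP 0 t; last by exists (fun=> 0).
  by have [u hu] := fourier_pair_onto (L2_duhamel F2 t0); exists u.
exists (fun t => if t == 0 then (fun=> 0) else U t); rewrite eqxx; split=> // t t0.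
have [->|_] := eqVneq t 0; last exact: hU.
rewrite (_ : (fun k => duhamel F k 0) = fun=> 0).
  have := fourier_pair_combo (R := R) [::]; congr fourier_pair.
    by apply/funext => x; rewrite /cfun /combo big_nil.
  by apply/funext => x; rewrite /combo !big_nil.
by apply/funext => k; rewrite duhamel0.
Qed.

Definition inv_oneDsqr_int : R := fine (\int[mu]_x ((1 + x ^+ 2)^-1)%:E).

(* The propagator loses [|lam k| >= c0 |k|] at high frequency, so the source
   enters the final state through a multiplier in L^2: a small uniform bound
   on [F] makes the contribution small whatever its L^2 norm. *)
Lemma sqn_duhamel_le F (e c0 t : R) : L2 F -> 0 <= t -> 0 < c0 -> 0 <= e ->
  (forall k, 1 <= `|k| -> c0 * `|k| <= `|lam k|) ->
  (forall k, k != 0 -> `|Re (F k)| <= e /\ `|Im (F k)| <= e) ->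
  sqn (fun k => Re (duhamel F k t)) + sqn (fun k => Im (duhamel F k t)) <=
  e ^+ 2 * (4 * ((8 * t) ^+ 2 + (12 / c0) ^+ 2) * inv_oneDsqr_int).
Proof.
move=> F2 t0 c00 e0 hlam hF.
have [D1 D2] := L2_duhamel F2 t0.
(* Both parts of F being at most e, their sum is at most 2e, and the two bounds of [norm_duhamel_le]
   become 8te and 12e / c0. The 2 in [K] pays for 1 + k^2 <= 2 max(1, k^2). *)
pose A : R := (8 * t) ^+ 2; pose B : R := (12 / c0) ^+ 2.
pose K : R := 2 * (A + B).
have A0 : 0 <= A by exact: sqr_ge0.
have B0 : 0 <= B by exact: sqr_ge0.
have K0 : 0 <= K by rewrite mulr_ge0// addr_ge0.
have m1 : measurable_fun setT (fun x : R => ((1 + x ^+ 2)^-1)%:E).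
  apply/measurable_EFinP; apply: measurable_funV; apply: measurable_funD => //.
have i0 (x : R) : 0 <= (1 + x ^+ 2)^-1 by rewrite invr_ge0 addr_ge0 ?sqr_ge0.
have JE : (\int[mu]_x ((1 + x ^+ 2)^-1)%:E = inv_oneDsqr_int%:E)%E.
  rewrite fineK// ge0_fin_numE ?(@integral_oneDsqr_lty R)//.
  by apply: integral_ge0 => x _; rewrite lee_fin.
have key (x k : R) : k != 0 -> `|x| <= 4 * t * (`|Re (F k)| + `|Im (F k)|) ->
    `|x| * (`|lam k| + `|om k|) <= 6 * (`|Re (F k)| + `|Im (F k)|) ->
    x ^+ 2 <= e ^+ 2 * K * (1 + k ^+ 2)^-1.
  move=> k0 x1 x2; have [f1 f2] := hF k k0.
  set f := `|Re (F k)| + _ in x1 x2.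
  have fe : f <= 2 * e by rewrite /f; lra.
  have p1 : 0 < 1 + k ^+ 2 by rewrite ltr_pwDl// sqr_ge0.
  rewrite ler_pdivlMr// -(real_normK (num_real x)) -(real_normK (num_real k)).
  have X0 := normr_ge0 x; have k00 := normr_ge0 k.
  have a1 : `|x| ^+ 2 <= A * e ^+ 2.
    rewrite -exprMn ler_pXn2r// ?nnegrE ?mulr_ge0//; apply: le_trans x1 _.
    rewrite (_ : 8 * t * e = 4 * t * (2 * e)); last by ring.
    by rewrite ler_wpM2l// mulr_ge0.
  have e2 : 0 <= e ^+ 2 by exact: sqr_ge0.
  have Ae : 0 <= A * e ^+ 2 by exact: mulr_ge0.
  have Be : 0 <= B * e ^+ 2 by exact: mulr_ge0.
  have KE : e ^+ 2 * K = 2 * (A * e ^+ 2) + 2 * (B * e ^+ 2) by rewrite /K; ring.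
  (* For |k| < 1 the low-frequency bound [A] suffices; for |k| >= 1 the decay [B] is used. *)
  have [k1|k1] := leP 1 `|k|; last first.
    have k2 : `|k| ^+ 2 <= 1 by rewrite expr_le1// ltW.
    have : `|x| ^+ 2 * `|k| ^+ 2 <= `|x| ^+ 2 by rewrite ler_piMr ?sqr_ge0.
    by rewrite KE mulrDr mulr1; lra.
  have a2 : `|x| * `|k| <= 12 / c0 * e.
    rewrite mulrAC ler_pdivlMr//; apply: (@le_trans _ _ (`|x| * (`|lam k| + `|om k|))).
      rewrite -mulrA ler_wpM2l// mulrC; apply: le_trans (hlam k k1) _.
      by rewrite lerDl.
    by lra.
  have a3 : `|x| ^+ 2 * `|k| ^+ 2 <= B * e ^+ 2.
    by rewrite -!exprMn ler_pXn2r// ?nnegrE ?mulr_ge0// ?invr_ge0// ltW.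
  have : `|x| ^+ 2 <= `|x| ^+ 2 * `|k| ^+ 2.
    by rewrite ler_peMr ?sqr_ge0// expr_ge1.
  by rewrite KE mulrDr mulr1; lra.
have main (g : R -> R) : g \in L2r ->
    (forall k, k != 0 -> g k ^+ 2 <= e ^+ 2 * K * (1 + k ^+ 2)^-1) ->
    sqn g <= e ^+ 2 * K * inv_oneDsqr_int.
  move=> g2 hg; rewrite -lee_fin -sqn_EFin// [leRHS]EFinM -JE -ge0_integralZl//; last first.
  - by rewrite lee_fin mulr_ge0// sqr_ge0.
  - by move=> x _; rewrite lee_fin.
  apply: ae_ge0_le_integral => //.
  - by move=> x _; rewrite lee_fin sqr_ge0.
  - by apply/measurable_EFinP; apply: measurable_funX; exact: measurable_Lfun2.
  - by move=> x _; rewrite -EFinM lee_fin mulr_ge0// mulr_ge0// sqr_ge0.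
  - exact: measurable_funeM.
  move: (@ae_neq0 R); apply: (@filterS _ _ (ae_filter_ringOfSetsType mu)) => k k0 _.
  by rewrite -EFinM lee_fin; exact: hg.
rewrite (_ : e ^+ 2 * _ = e ^+ 2 * K * inv_oneDsqr_int + e ^+ 2 * K * inv_oneDsqr_int); last first.
  by rewrite -/A -/B /K; ring.
apply: lerD; apply: main => // k k0.
- by have [[h1 h2] [h3 h4]] := norm_duhamel_le om lam_le0 F k t0; exact: key.
- by have [[h1 h2] [h3 h4]] := norm_duhamel_le om lam_le0 F k t0; exact: key.
Qed.

End multiplier_solution.

(** * The evolution equation *)

Section symbol.
Context {R : realType}.
Local Notation mu := (@lebesgue_measure R).
Local Notation Re := (@complex.Re R).
Local Notation Im := (@complex.Im R).
Variables (alpha theta nu d : R).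
Hypotheses (halpha : 1 < alpha <= 2)
  (htheta : `|theta| <= Num.min alpha (2 - alpha)) (hd : 0 < d).

Let c : R := theta * pi / 2.

Definition symbol_re (k : R) : R := - (d * (`|k| `^ alpha * cos c)).
Definition symbol_im (k : R) : R := nu * k - d * (`|k| `^ alpha * (Num.sg k * sin c)).

(** The sign of k leaves the real part because cosine is even; at k = 0, where the sign is 0, the
    power vanishes since alpha != 0. *)
Lemma symbolE k : 'i * (nu * k)%:C - d%:C * psi alpha theta k =
  symbol_re k +i* symbol_im k.
Proof.
have a0 : alpha != 0 by move: halpha; lra.
have cE : `|k| `^ alpha * cos (Num.sg k * c) = `|k| `^ alpha * cos c.
  case: sgrP => _; first by rewrite powR0// !mul0r.
    by rewrite mul1r.
  by rewrite mulN1r cosN.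
apply/eqP; rewrite eq_complex cReB cImB !cReM !cImM /= ?cReM ?cImM /=.
rewrite -/c cE sin_sg /symbol_re /symbol_im.
by apply/andP; split; apply/eqP; ring.
Qed.

(** |theta| <= 2 - alpha < 1 keeps the angle strictly inside ]-pi/2, pi/2[; dissipativity rests on
    this. *)
Lemma symbol_angle : 0 < cos c.
Proof.
have th : `|theta| < 1 by move: htheta; rewrite le_min => /andP[_]; move: halpha; lra.
have p0 := pi_gt0 R; move: th => /ltr_normlP[t1 t2].
apply: cos_gt0_pihalf; rewrite /c; apply/andP; split; nra.
Qed.

Lemma symbol_re_le0 k : symbol_re k <= 0.
Proof.
rewrite /symbol_re oppr_le0 mulr_ge0 ?(ltW hd)// mulr_ge0 ?powR_ge0//.
exact: ltW symbol_angle.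
Qed.

Lemma symbol_re_neq0 k : k != 0 -> symbol_re k != 0.
Proof.
move=> k0; rewrite /symbol_re oppr_eq0 !mulf_neq0 ?gt_eqF ?powR_gt0 ?normr_gt0//.
exact: symbol_angle.
Qed.

Lemma symbol_re_growth k : 1 <= `|k| -> d * cos c * `|k| <= `|symbol_re k|.
Proof.
move=> k1; rewrite [leRHS]ler0_norm ?symbol_re_le0// /symbol_re opprK (mulrC (_ `^ _)) mulrA.
rewrite ler_wpM2l ?mulr_ge0 ?(ltW hd) ?(ltW symbol_angle)//.
rewrite -[leLHS]powRr1//; apply: ler_powR => //.
by move: halpha => /andP[/ltW].
Qed.

Lemma measurable_symbol_re : measurable_fun setT symbol_re.
Proof.
apply: measurableT_comp => //; apply: measurable_funM => //; apply: measurable_funM => //.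
by apply: (@measurableT_comp _ _ _ _ _ _ (@powR R ^~ alpha)); first exact: measurable_powR.
Qed.

Lemma measurable_symbol_im : measurable_fun setT symbol_im.
Proof.
have msg : measurable_fun setT (@Num.sg R).
  rewrite (_ : @Num.sg R = fun k => \1_`]0, +oo[ k - \1_`]-oo, 0[ k).
    by apply: measurable_funB; exact: measurable_indic.
  apply/funext => k; rewrite !indicE.
  case: sgrP => [->|k0|k0].
  - by rewrite !memNset ?subrr//= in_itv/= ltxx.
  - rewrite mem_set ?memNset ?subr0//= in_itv/=; first by rewrite ltNge ltW.
    by rewrite k0.
  - rewrite memNset ?mem_set ?sub0r//= in_itv/= ?k0//.
    by rewrite andbT ltNge ltW.
apply: measurable_funB; first exact: measurable_funM.
apply: measurable_funM => //; apply: measurable_funM; last exact: measurable_funM.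
by apply: (@measurableT_comp _ _ _ _ _ _ (@powR R ^~ alpha)); first exact: measurable_powR.
Qed.

(** The homogeneous part [U] is a parameter, so that solutions for different sources can share it
    and differ only in [W]. *)
Lemma is_solution_sum (g0 f G F : R -> R[i]) (U W : R -> R -> R[i]) :
  fourier_pair g0 G -> L2 G -> fourier_pair f F -> L2 F ->
  U 0 = g0 -> W 0 = (fun=> 0) ->
  (forall t, 0 <= t -> fourier_pair (U t) (fun k => propagate symbol_re symbol_im G k t)) ->
  (forall t, 0 <= t -> fourier_pair (W t) (fun k => duhamel symbol_re symbol_im F k t)) ->
  is_solution alpha theta nu d g0 f (fun x t => U t x + W t x).
Proof.
move=> gG G2 fF F2 U0 W0 hU hW.
have mre := measurable_symbol_re; have mim := measurable_symbol_im.
have hS t : 0 <= t -> is_fourierL2 (fun x => U t x + W t x)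
    (fun k => solution_hat symbol_re symbol_im G F k t).
  by move=> t0; apply: fourier_pairP; apply: fourier_pairD; [exact: hU|exact: hW].
split.
- by move=> t /hS[].
- by apply: aeW => x; rewrite U0 W0 addr0.
exists (solution_hat symbol_re symbol_im G F), G, F; split.
- exact: fourier_pairP.
- exact: fourier_pairP.
- have [G1 G1'] := measurable_L2 G2; have [F1 F1'] := measurable_L2 F2.
  have m1 : measurable_fun setT (fun kt : R * R => kt.1) by exact: measurable_fst.
  have m2 : measurable_fun setT (fun kt : R * R => kt.2) by exact: measurable_snd.
  have [p1 p2] := measurable_propagate mre mim m1 m2 G1 G1'.
  have [q1 q2] := measurable_duhamel mre mim m1 m2 F1 F1'.
  split; apply: measurable_funTS.
    rewrite [X in measurable_fun _ X](_ : _ = fun kt : R * R =>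
      Re (propagate symbol_re symbol_im G kt.1 kt.2) +
      Re (duhamel symbol_re symbol_im F kt.1 kt.2)).
      exact: measurable_funD.
    by apply/funext => kt; rewrite /solution_hat cReD.
  rewrite [X in measurable_fun _ X](_ : _ = fun kt : R * R =>
    Im (propagate symbol_re symbol_im G kt.1 kt.2) +
    Im (duhamel symbol_re symbol_im F kt.1 kt.2)).
    exact: measurable_funD.
  by apply/funext => kt; rewrite /solution_hat cImD.
- move=> t t0; exists (fun k => solution_hat symbol_re symbol_im G F k t).
  by split; [exact: hS|exact: aeW].
(* At k = 0 the symbol vanishes and [duhamel] has a default value, so the equation is checked for k
   != 0 only. *)
move: (@ae_neq0 R); apply: (@filterS _ _ (ae_filter_ringOfSetsType mu)) => k k0.
have [E1 E2] := solution_hatE symbol_re symbol_im G F k.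
have cE (c1 c2 c3 : R) : continuous (fun t => expRe symbol_re symbol_im k t * c1 +
    expIm symbol_re symbol_im k t * c2 + c3).
  move=> t; apply/differentiable_continuous/derivable1_diffP.
  by case: (is_derive_exp (symbol_re k) (symbol_im k) c1 c2 c3 t).
split.
- by rewrite E1; apply: continuous_subspaceT; exact: cE.
- by rewrite E2; apply: continuous_subspaceT; exact: cE.
- move=> t _; rewrite symbolE.
  by apply: solution_hat_ode; left; exact: symbol_re_neq0.
- exact: solution_hat0.
Qed.

End symbol.

(** * Spikes and instability *)

Lemma L2_hat (R : realType) (h H : R -> R[i]) : fourier_pair h H -> L2 H.
Proof. by move=> /fourier_pairP[]. Qed.

Lemma norm_cstep_le (R : realType) (a k : R) : k != 0 -> `|cstep a k| <= `|a|.
Proof.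
move=> k0; rewrite /cstep normrM normfV ler_pdivrMr ?normr_gt0//.
by rewrite mulrC -normrM norm_sin_le.
Qed.

Lemma norm_sstep_le (R : realType) (a k : R) : k != 0 -> `|sstep a k| <= `|a|.
Proof.
move=> k0; rewrite /sstep normrM normfV ler_pdivrMr ?normr_gt0//.
rewrite ger0_norm ?subr_ge0 ?cos_le1// mulrC -normrM.
exact: one_sub_cos_norm_le.
Qed.

Theorem theorem4p3p1 (R : realType) (alpha theta nu d T : R) (g0 : R -> R)
  (halpha : 1 < alpha <= 2)
  (htheta : `|theta| <= Num.min alpha (2 - alpha))
  (hd : 0 < d) (hT : 0 < T)
  (hg0 : L2 (cfun g0)) :
  exists (f : R -> R) (f_ : nat -> R -> R)
         (u : R -> R -> R[i]) (u_ : nat -> R -> R -> R[i]),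
    [/\ L2 (cfun f) /\ (forall n, L2 (cfun (f_ n))),
        is_solution alpha theta nu d (cfun g0) (cfun f) u,
        forall n, is_solution alpha theta nu d (cfun g0) (cfun (f_ n)) (u_ n),
        cvgL2 (fun n => (u_ n) ^~ T) (u ^~ T) &
        ~ cvgL2 (fun n => cfun (f_ n)) (cfun f)].
Proof.
pose lam := symbol_re alpha theta d; pose om := symbol_im alpha theta nu d.
have mlam : measurable_fun setT lam by exact: measurable_symbol_re.
have mom : measurable_fun setT om by exact: measurable_symbol_im.
have lam0 k : lam k <= 0 by exact: symbol_re_le0.
have [G gG] := fourier_pair_ex hg0; have G2 := L2_hat gG.
have [U [U0 hU]] := propagator_ex mlam mom lam0 gG G2.
(* Height sqrt(n+1) on [0, 1/(n+1)[: the squared norm is 1, while height times width, which bounds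
   the transform, is 1 / sqrt(n+1). *)
pose s n : seq (R * R) := [:: (Num.sqrt n.+1%:R, n.+1%:R^-1)].
pose f_ n := combo estep (s n).
pose F n k := combo cstep (s n) k +i* combo sstep (s n) k.
have fF n : fourier_pair (cfun (f_ n)) (F n) by exact: fourier_pair_combo.
have F2 n : L2 (F n) := L2_hat (fF n).
have f2 n : L2 (cfun (f_ n)) by have [] := fourier_pairP (fF n).
have /choice[W hW] n := duhamel_ex mlam mom lam0 (F2 n).
have f0 : fourier_pair (cfun (fun=> 0 : R)) (fun=> 0).
  have := fourier_pair_combo (R := R) [::]; congr fourier_pair.
    by apply/funext => x; rewrite /cfun /combo big_nil.
  by apply/funext => x; rewrite /combo !big_nil.
have z2 := L2_hat f0.
(* The summand 0 is the [W] of the zero source, kept so that [is_solution_sum] applies to [u] as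
   well. *)
exists (fun=> 0), f_, (fun x t => U t x + 0), (fun n x t => U t x + W n t x).
have e0 n : 0 <= (n.+1%:R^-1 : R) by rewrite invr_ge0.
have C0 := @hartley_cst_gt0 R.
split.
- by split => //; have [] := fourier_pairP f0.
- apply: (is_solution_sum halpha htheta hd gG G2 f0 z2 U0) => // t t0.
  rewrite (_ : (fun k => _) = fun=> 0); first exact: f0.
  by apply/funext => k; rewrite duhamel_source0.
- by move=> n; apply: (is_solution_sum halpha htheta hd gG G2 (fF n) (F2 n) U0) (hW n).2 => //; exact: (hW n).1.
- have WT n := (hW n).2 _ (ltW hT).
  have WE n : (fun x => (U T x + W n T x) - (U T x + 0)) = W n T.
    by apply/funext => x; rewrite addr0 addrC addKr.
  have W2 n : L2 (W n T) by have [] := fourier_pairP (WT n).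
  have D2 n := L2_duhamel mlam mom lam0 (F2 n) (ltW hT).
  pose c0 := d * cos (theta * pi / 2).
  have c00 : 0 < c0 by rewrite mulr_gt0// (symbol_angle halpha htheta).
  (* The squared uniform bound on [F n] is 1 / (n+1); the other factors do not depend on n. *)
  have [J hJ] : exists J, forall n,
      sqn (fun x => complex.Re (W n T x)) + sqn (fun x => complex.Im (W n T x)) <= J * n.+1%:R^-1.
    exists (16 / hartley_cst * (4 * ((8 * T) ^+ 2 + (12 / c0) ^+ 2) * inv_oneDsqr_int)) => n.
    apply: le_trans (fourier_pair_sqn_le (D2 n) (WT n)) _.
    rewrite -[leRHS]mulrA ler_wpM2l//; first by rewrite divr_ge0// ltW.
    have Fb k : k != 0 -> `|complex.Re (F n k)| <= Num.sqrt n.+1%:R^-1 /\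
                `|complex.Im (F n k)| <= Num.sqrt n.+1%:R^-1.
      have sE : Num.sqrt n.+1%:R * n.+1%:R^-1 = Num.sqrt n.+1%:R^-1 :> R.
        rewrite -{2}(sqr_sqrtr (ler0n R n.+1)) sqrtrV// expr2.
        by rewrite invfM mulrA divff ?mul1r// sqrtr_eq0 -ltNge ltr0n.
      move=> k0; rewrite /F /= /combo !big_cons !big_nil !addr0 /= -sE !(normrM (Num.sqrt _)).
      rewrite ger0_norm ?sqrtr_ge0//; split; rewrite ler_wpM2l ?sqrtr_ge0//.
        by apply: le_trans (norm_cstep_le _ k0) _; rewrite ger0_norm.
      by apply: le_trans (norm_sstep_le _ k0) _; rewrite ger0_norm.
    have := sqn_duhamel_le mlam mom lam0 (F2 n) (ltW hT) c00 (sqrtr_ge0 _)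
      (@symbol_re_growth _ _ _ _ halpha htheta hd) Fb.
    by rewrite sqr_sqrtr// mulrC.
  have J0 : (fun n => J * n.+1%:R^-1) @ \oo --> (0 : R).
    by rewrite -[X in _ --> X](mulr0 J); apply: cvgMr; exact: cvg_harmonic.
  apply: cvgL2_sqn => [n| |].
  + by rewrite WE.
  + under eq_fun do under eq_fun do rewrite [U T _ + 0]addr0 [U T _ + _]addrC addrK.
    apply: cvg0_squeeze J0 => n; rewrite sqn_ge0 /=.
    by apply: le_trans (hJ n); rewrite lerDl sqn_ge0.
  under eq_fun do under eq_fun do rewrite [U T _ + 0]addr0 [U T _ + _]addrC addrK.
  apply: cvg0_squeeze J0 => n; rewrite sqn_ge0 /=.
  by apply: le_trans (hJ n); rewrite lerDr sqn_ge0.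
have f1 n : normL2 (fun x => cfun (f_ n) x - cfun (fun=> 0) x) = 1%E.
  rewrite (_ : (fun x => _) = cfun (f_ n)); last first.
    by apply/funext => x; rewrite /cfun subr0.
  rewrite normL2_sqn//= (_ : sqn (fun=> 0) = 0) ?addr0; last exact: dot0l.
  rewrite (_ : (fun x => f_ n x) = fun x => Num.sqrt n.+1%:R * estep n.+1%:R^-1 x); last first.
    by apply/funext => x; rewrite /f_ /combo big_cons big_nil addr0.
  rewrite sqnZ ?Lfun2_estep// sqr_sqrtr//.
  have -> : sqn (estep n.+1%:R^-1 : R -> R) = n.+1%:R^-1.
    rewrite -[RHS]ger0_norm// -[X in `|X|]subr0 -sqn_estepB; congr sqn.
    by apply/funext => x; rewrite [estep 0 x]subrr subr0.
  by rewrite mulfV ?sqrtr1.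
rewrite /cvgL2 (_ : (fun n => _) = fun=> 1%E); last by apply/funext => n; exact: f1.
move=> /(cvg_unique (@ereal_hausdorff R) (cvg_cst 1%E)) /eqP.
by rewrite eqe oner_eq0.
Qed.
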